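(* For every integer $\ell\ge 1$, $$|B_{SO(2\ell)}\backslash\mathcal{B}_{\mathfrak{so}(2\ell+1)}|=\sum_{k=1}^{\ell+1}\frac{\ell!}{(k-1)!}\binom{\ell}{k-1}2^{\ell-k+1}.$$
   Context: Over $\mathbb{C}$: $SO(2\ell+1)$ is the group of determinant-one linear maps of $\mathbb{C}^{2\ell+1}$ preserving the symmetric bilinear form $\beta$ with $\beta(e_j,e_k)=\delta_{j,-k}$, where $e_1,\dots,e_\ell,e_0,e_{-\ell},\dots,e_{-1}$ is an ordered basis of $\mathbb{C}^{2\ell+1}$. $\mathcal{B}_{\mathfrak{so}(2\ell+1)}$ is the flag variety of $\mathfrak{so}(2\ell+1)$ (variety of Borel subalgebras). $SO(2\ell)\subset SO(2\ell+1)$ is the subgroup fixing $e_0$, and $B_{SO(2\ell)}$ is the intersection of $SO(2\ell)$ with the group of upper triangular matrices with respect to the ordered basis above; it is a Borel subgroup of $SO(2\ell)$. $H\backslash X$ denotes the set of $H$-orbits on $X$. *)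

(* Defs.v *)
From mathcomp Require Import all_boot all_order all_algebra.
From mathcomp Require Import boolp classical_sets functions cardinality reals.
From mathcomp Require Import complex.

Set Implicit Arguments.
Unset Strict Implicit.
Unset Printing Implicit Defensive.

Import Order.TTheory GRing.Theory Num.Theory.

Local Open Scope classical_set_scope.
Local Open Scope ring_scope.

Section LieAlgebra.
Variables (F : fieldType) (n : nat).
Implicit Types (X Y : 'M[F]_n) (U V a b : {vspace 'M[F]_n}).

Definition lie_bracket X Y : 'M[F]_n := X *m Y - Y *m X.

(* By bilinearity, this is the span of all [X, Y] with X in U and Y in V. *)
Definition lie_prod U V : {vspace 'M[F]_n} :=
  <<[seq lie_bracket X Y | X <- vbasis U, Y <- vbasis V]>>%VS.

Definition lie_subalgebra a : Prop :=
  forall X Y, X \in a -> Y \in a -> lie_bracket X Y \in a.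

Definition derived_series a (k : nat) : {vspace 'M[F]_n} :=
  iter k (fun U => lie_prod U U) a.

Definition lie_solvable a : Prop := exists k, derived_series a k = 0%VS.

Definition solvable_subalgebra (g : set 'M[F]_n) b : Prop :=
  [/\ [set` b] `<=` g, lie_subalgebra b & lie_solvable b].

Definition borel_subalgebra (g : set 'M[F]_n) b : Prop :=
  solvable_subalgebra g b /\
  forall b', solvable_subalgebra g b' -> (b <= b')%VS -> b' = b.

Definition Ad (g : 'M[F]_n) b : {vspace 'M[F]_n} :=
  (linfun (mulmxr (invmx g) \o mulmx g) @: b)%VS.

End LieAlgebra.

Definition orbits (G T : Type) (act : G -> T -> T) (H : set G) (X : set T) :
    set (set T) :=
  [set O | exists2 x, X x & O = [set act g x | g in H]].

(* Vectors are columns of coordinates in the ordered basis                    *)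
(* e_1, ..., e_l, e_0, e_{-l}, ..., e_{-1}: for 1 <= k <= l, e_k has index    *)
(* k - 1 and e_{-k} has index 2l + 1 - k, and e_0 has index l. Thus rev_ord   *)
(* exchanges the indices of e_j and e_{-j}. Maps act by left multiplication.  *)
Section OddOrthogonal.
Variables (R : realType) (l : nat).
Notation C := R[i].
Notation N := l.*2.+1.

Definition beta (u v : 'cV[C]_N) : C := \sum_(i < N) u i 0 * v (rev_ord i) 0.

Definition e0 : 'cV[C]_N := delta_mx (inord l) 0.

Definition SO_odd : set 'M[C]_N :=
  [set g | (forall u v, beta (g *m u) (g *m v) = beta u v) /\ \det g = 1].

Definition SO_even : set 'M[C]_N := [set g | SO_odd g /\ g *m e0 = e0].

Definition upper_triangular : set 'M[C]_N :=
  [set g | forall i j : 'I_N, (j < i)%N -> g i j = 0].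

Definition B_SO_even : set 'M[C]_N := SO_even `&` upper_triangular.

Definition so_odd : set 'M[C]_N :=
  [set X | forall u v, beta (X *m u) v + beta u (X *m v) = 0].

Definition flag_variety : set {vspace 'M[C]_N} :=
  [set b | borel_subalgebra so_odd b].

End OddOrthogonal.

Arguments SO_odd R l : clear implicits.
Arguments SO_even R l : clear implicits.
Arguments upper_triangular R l : clear implicits.
Arguments B_SO_even R l : clear implicits.
Arguments so_odd R l : clear implicits.
Arguments flag_variety R l : clear implicits.

(* Main.v *)
Require Import Defs.
From HB Require Import structures.
From mathcomp Require Import all_boot all_order all_algebra.
From mathcomp Require Import fingroup perm zify ring.

(** By Lie's theorem a solvable subalgebra of so(2l+1) stabilizes a maximal
    isotropic flag, so the Borel subalgebras are the conjugates of the algebra b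
    of upper triangular elements; the normalizer of b in SO(2l+1) is the group
    B of upper triangular elements, because a regular nilpotent matrix has a
    single invariant subspace in each dimension. The orbits are therefore the
    double cosets B' \ SO(2l+1) / B with B' the Borel subgroup of SO(2l), that
    is, the B'-orbits of flags V_1 < ... < V_l of isotropic subspaces.

    Every flag is brought to a normal form given by a signed partial permutation
    of {1, ..., l}, by induction on l through e_1^perp / e_1: let i be the first
    position with e_1 in V_i, or else with V_i not orthogonal to e_1, and apply
    induction to the flag without its i-th step. In the first case e_1 goes to
    position i; in the second, e_{-1} does if V_i has a vector of e_0^perp that
    is not orthogonal to e_1, and otherwise the index 1 and the position i are
    left free. The signed partial permutation can be recovered from the leading
    terms (e_0 being ignored) of the vectors of V_i and of its intersection with
    e_0^perp. There are l!/j! * C(l, j) * 2^(l-j) signed partial permutations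
    leaving j positions free. *)

Set Implicit Arguments.
Unset Strict Implicit.
Unset Printing Implicit Defensive.

Import Order.TTheory GRing.Theory Num.Theory.

(** * Counting signed partial permutations *)

(** The anisotropic vector e_0 shapes the argument. An element of B' fixes it, hence preserves the
    e_0-coordinate of every vector and acts triangularly on the other coordinates: that coordinate
    is an invariant of its own, which leading terms must ignore. A free position is one whose vector
    cannot lose its e_0-coordinate, by means of earlier ones, without changing its leading term.
    Isotropy then forces a hyperbolic compensation: 1 - 1/2 - 1/2 = 0 is the origin of the
    coefficient -1/2, and since free columns are also orthogonal to one another, they all share the
    same pair e_m, e_{-m}. A partial permutation is stored as a full permutation with two sets of
    indices, so that induction on l amounts to inserting one value into a permutation. Lie's theorem
    yields eigenvectors that may be anisotropic; two such vectors have to be combined. The passage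
    from O to SO is cheap: a sign along the anisotropic direction corrects the determinant in Witt's
    theorem, and triangular orthogonal matrices fixing e_0 have determinant 1. *)

Section CountCodes.
Local Open Scope nat_scope.
Variable l : nat.
Implicit Types (E S : {set 'I_l}) (s t : 'S_l).

Definition incr_on E t :=
  [forall x in E, forall y in E, (x < y) ==> (t x < t y)].

Lemma incr_onP E t :
  reflect (forall x y : 'I_l, x \in E -> y \in E -> x < y -> t x < t y) (incr_on E t).
Proof.
apply: (iffP forall_inP) => [H x y xE yE xy|H x xE].
  by have /forall_inP/(_ y yE)/implyP := H x xE; apply.
by apply/forall_inP => y yE; apply/implyP; apply: H.
Qed.

Lemma incr_perm_on_id E s : perm_on E s -> incr_on E s -> s = 1%g.
Proof.
move=> sE /incr_onP incr; apply/permP => x; rewrite perm1.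
have [d] := ubnP x; elim: d x => // d IH x xd.
have {}IH (y : 'I_l) : y < x -> s y = y by move=> yx; apply: IH; apply: leq_trans yx _.
have [xE|] := boolP (x \in E); last by move=> /(out_perm sE).
have [sx|sx|/val_inj//] := ltngtP (s x) x.
  by have := IH _ sx => /perm_inj sxx; move: sx; rewrite sxx ltnn.
pose y := (s^-1)%g x; have sy : s y = x by rewrite permKV.
have yE : y \in E by rewrite -(perm_closed _ sE) sy.
have [yx|xy|/val_inj yx] := ltngtP y x.
- by have yx' : y = x by [rewrite -sy (IH y yx)]; move: yx; rewrite yx' ltnn.
- by have := incr _ _ xE yE xy; rewrite sy => /(ltn_trans sx); rewrite ltnn.
- by rewrite -{1}yx sy.
Qed.

(** Rearrangement inequality: if s maximizes the sum of i times the image of i, then no two values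
    on E are out of order, since exchanging them would increase the sum. *)
Lemma incr_on_factor E t : exists2 s, perm_on E s & incr_on E (s * t)%g.
Proof.
pose w (s : 'S_l) := \sum_(i < l) i * (s * t)%g i.
case: (@arg_maxnP _ 1%g (fun s => perm_on E s) w (perm_on1 E)) => s sE smax.
exists s => //; apply/incr_onP => x y xE yE xy; rewrite ltnNge; apply/negP.
set u := (s * t)%g; rewrite leq_eqVlt => /orP[/eqP/val_inj/perm_inj yx|uyx].
  by move: xy; rewrite yx ltnn.
have /smax : perm_on E (tperm x y * s)%g.
  apply: perm_onM => //; apply: (subset_trans (tperm_on x y)).
  by rewrite subUset !sub1set xE.
have yx : y != x by rewrite neq_ltn xy orbT.
rewrite /w /= leqNgt => /negP; apply.
rewrite (bigD1 x) //= (bigD1 y) //= [X in _ < X](bigD1 x) //= [X in _ < _ + X](bigD1 y) //=.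
rewrite -!mulgA -/u !permM tpermL tpermR.
rewrite [X in _ < _ + (_ + X)](eq_bigr (fun i : 'I_l => i * u i)); last first.
  by move=> i /andP[ix iy]; rewrite permM tpermD // eq_sym.
rewrite !addnA ltn_add2r; move: uyx xy; rewrite /u !permM.
move: (nat_of_ord (t (s x))) (nat_of_ord (t (s y))) (nat_of_ord x) (nat_of_ord y).
move=> a b c d ba cd.
by nia.
Qed.

Lemma card_incr_on E : #|[set t | incr_on E t]| * #|E|`! = l`!.
Proof.
rewrite -card_perm -[#|perm_on E|]cardsE -cardsX.
rewrite -[RHS](_ : #|[set: 'S_l]| = _); last by rewrite cardsT card_Sn.
rewrite -(card_in_imset (f := fun c : 'S_l * 'S_l => (c.2 * c.1)%g)).
  apply: eq_card => t; rewrite [RHS]inE; apply/imsetP.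
  have [s sE incr] := incr_on_factor E t; exists ((s * t)%g, (s^-1)%g).
    by rewrite !inE incr /=; apply: perm_onV.
  by rewrite /= mulKg.
move=> [t1 s1] [t2 s2]; rewrite !inE /= => /andP[/incr_onP i1 p1] /andP[/incr_onP i2 p2] e.
suff s12 : (s2^-1 * s1)%g = 1%g.
  have s21 : s1 = s2 by rewrite -[s1](mulKVg s2) s12 mulg1.
  by move: e; rewrite s21 => /mulgI ->.
have pE : perm_on E (s2^-1 * s1)%g by apply: perm_onM => //; rewrite perm_onV.
apply: (incr_perm_on_id pE); apply/incr_onP => x y xE yE xy.
have te z : t2 z = t1 ((s2^-1 * s1)%g z).
  by rewrite -[RHS]permM -mulgA e mulKg.
move: (i2 x y xE yE xy); rewrite !te; set a := (X in t1 X < _); set b := (X in _ < t1 X) => ab.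
have aE : a \in E by rewrite perm_closed.
have bE : b \in E by rewrite perm_closed.
rewrite ltnNge leq_eqVlt; apply/negP => /orP[/eqP/val_inj ba|ba].
  by move: ab; rewrite (ba : b = a) ltnn.
by have := ltn_trans ab (i1 _ _ bE aE ba); rewrite ltnn.
Qed.

Lemma card_supersets E : #|[set S : {set 'I_l} | E \subset S]| = 2 ^ (l - #|E|).
Proof.
rewrite -[X in 2 ^ (X - _)](card_ord l) -(cardsC E) addKn -card_powerset.
rewrite -(card_in_imset (f := fun X => E :|: X) (D := powerset (~: E))); last first.
  move=> X Y; rewrite !powersetE => XE YE /setP EXY; apply/setP => i.
  have := EXY i; rewrite !inE; case iE : (i \in E) => //= _.
  have nE (Z : {set 'I_l}) : Z \subset ~: E -> (i \in Z) = false.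
    by move=> /subsetP ZE; apply/negP => /ZE; rewrite inE iE.
  by rewrite !nE.
apply: eq_card => S; rewrite inE; apply/idP/imsetP => [ES|[X _ ->]]; last exact: subsetUl.
exists (S :\: E); first by rewrite powersetE setDE subsetIr.
by rewrite setDE setUIr setUCr setIT; apply/esym/setUidPr.
Qed.

Definition codes := [set c : {set 'I_l} * {set 'I_l} * 'S_l |
  (c.1.1 \subset c.1.2) && incr_on c.1.1 c.2].

Lemma card_codes :
  #|codes| = \sum_(1 <= k < l.+2) l`! %/ (k - 1)`! * 'C(l, k - 1) * 2 ^ (l.+1 - k).
Proof.
rewrite big_add1 /= big_mkord.
transitivity (\sum_(E : {set 'I_l}) l`! %/ #|E|`! * 2 ^ (l - #|E|)).
  rewrite -sum1_card (partition_big (fun c => c.1.1) xpredT) //=.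
  apply: eq_bigr => E _; rewrite -(card_incr_on E) mulnK ?fact_gt0 //.
  rewrite mulnC -card_supersets -cardsX -sum1_card.
  rewrite (reindex (fun c : {set 'I_l} * 'S_l => ((E, c.1), c.2))) /=.
    by apply: eq_bigl => c; rewrite !inE eqxx andbT.
  exists (fun c => (c.1.2, c.2)) => [[S t]|[[E' S] t]] //=.
  by rewrite inE /= => /andP[_ /eqP ->].
rewrite (partition_big (fun E : {set 'I_l} => inord #|E| : 'I_l.+1) xpredT) //=.
apply: eq_bigr => j _; rewrite !subSS !subn0.
rewrite (eq_bigl (fun E : {set 'I_l} => #|E| == j)); last first.
  move=> E; rewrite -val_eqE /= inordK // ltnS -[X in _ <= X](card_ord l); exact: max_card.
rewrite (eq_bigr (fun=> l`! %/ j`! * 2 ^ (l - j))) => [|E /eqP -> //].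
rewrite sum_nat_const -[#|_|]cardsE card_draws card_ord.
by rewrite mulnCA mulnA.
Qed.

End CountCodes.

From mathcomp Require Import boolp classical_sets functions cardinality reals.
From mathcomp Require Import complex.

Local Open Scope ring_scope.

(** * Lie's theorem *)

Section LieAlgebras.
Variables (F : fieldType) (n : nat).
Implicit Types (X Y : 'M[F]_n) (a b U V W : {vspace 'M[F]_n}).

Lemma lie_prodP U V W :
  (forall X Y, X \in U -> Y \in V -> lie_bracket X Y \in W) ->
  (lie_prod U V <= W)%VS.
Proof.
move=> UVW; apply/span_subvP => _ /allpairsP[[X Y] [/= XU YV ->]].
by apply: UVW; apply: vbasis_mem.
Qed.

Lemma lie_bracket_prod U V X Y :
  X \in U -> Y \in V -> lie_bracket X Y \in lie_prod U V.
Proof.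
move=> /coord_vbasis-> /coord_vbasis->; rewrite /lie_bracket.
rewrite mulmx_suml mulmx_sumr -sumrB rpred_sum // => i _.
rewrite mulmx_sumr mulmx_suml -sumrB rpred_sum // => j _.
rewrite -!scalemxAl -!scalemxAr [X in _ - X]scalerA mulrC -scalerA.
rewrite -!scalerBr !rpredZ // memv_span //.
by apply/allpairsP; exists ((vbasis U)`_i, (vbasis V)`_j); rewrite !mem_nth ?size_tuple.
Qed.

Lemma derived_series_sub a b k :
  (a <= b)%VS -> (derived_series a k <= derived_series b k)%VS.
Proof.
move=> ab; elim: k => //= k /subvP IH; apply: lie_prodP => X Y Xa Ya.
by apply: lie_bracket_prod; apply: IH.
Qed.

(** A nonzero solvable algebra differs from its derived algebra, and every subspace between [b, b]
    and b is an ideal; so a hyperplane of b avoiding some Y outside [b, b] serves in the induction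
    for Lie's theorem. *)
Lemma solvable_hyperplane b :
  lie_subalgebra b -> lie_solvable b -> b != 0%VS ->
  exists a Y, [/\ (lie_prod b b <= a)%VS, lie_subalgebra a, lie_solvable a,
    (\dim a < \dim b)%N & (a + <[Y]>)%VS = b].
Proof.
move=> subb [k solb] b0.
have bb : (lie_prod b b <= b)%VS by apply: lie_prodP.
have [Y Yb Ybb] : exists2 Y, Y \in b & Y \notin lie_prod b b.
  apply: contrapT => noY.
  have {}bb : lie_prod b b = b.
    apply/eqP; rewrite eqEsubv bb /=; apply/subvP => X Xb.
    by apply: contrapT => /negP XN; apply: noY; exists X.
  suff: derived_series b k = b by rewrite solb => /esym/eqP; rewrite (negPf b0).
  by elim: (k) => //= j ->.
set d := lie_prod b b in bb Ybb *.
pose c := (b :\: (d + <[Y]>))%VS.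
have dYb : (d + <[Y]> <= b)%VS by rewrite subv_add bb.
have dYc : ((d + <[Y]>) + c)%VS = b by rewrite addvC addv_diff; apply/addv_idPl.
have Yc : Y \notin (d + c)%VS.
  apply/negP => /memv_addP[x xd [y yc Yxy]].
  have : y \in (c :&: (d + <[Y]>))%VS.
    rewrite memv_cap yc /=.
    have -> : y = Y - x by rewrite Yxy addrAC subrr add0r.
    apply: rpredB; last exact: (subvP (addvSl _ _)).
    by apply: (subvP (addvSr _ _)); apply: memv_line.
  rewrite capv_diff memv0 => /eqP y0.
  by move: Ybb; rewrite Yxy y0 addr0 xd.
have acb : (d + c <= b)%VS by rewrite subv_add bb diffvSl.
exists (d + c)%VS, Y; split.
- exact: addvSl.
- move=> X Z XA ZA; apply: (subvP (addvSl _ _)).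
  by apply: lie_bracket_prod; apply: (subvP acb).
- by exists k; apply/eqP; rewrite -subv0 -solb derived_series_sub.
- rewrite ltn_neqAle dimvS // andbT; apply: contra Yc => /eqP dd.
  suff -> : (d + c)%VS = b by [].
  by apply/eqP; rewrite eqEdim acb dd /=.
- by rewrite -addvA (addvC c) addvA.
Qed.

End LieAlgebras.

(** * Krylov subspaces *)

Section Krylov.
Variables (F : fieldType) (m : nat) (w : 'rV[F]_m.+1) (Y : 'M[F]_m.+1).

Definition krylov k : 'M[F]_(k, m.+1) := \matrix_(i < k) (w *m Y ^+ i).

Lemma krylov_S k : (krylov k.+1 :=: krylov k + w *m Y ^+ k)%MS.
Proof.
apply/eqmxP/andP; split.
  apply/row_subP => i; rewrite rowK; have [ik|ki] := ltnP i k.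
    apply: submx_trans (addsmxSl _ _).
    by apply: submx_trans (row_sub (Ordinal ik) _); rewrite rowK.
  by have -> : i = k :> nat by [apply/eqP; rewrite eqn_leq ki -ltnS ltn_ord]; apply: addsmxSr.
rewrite addsmx_sub; apply/andP; split.
  apply/row_subP => i.
  by apply: submx_trans (row_sub (widen_ord (leqnSn k) i) _); rewrite !rowK.
by apply: submx_trans (row_sub ord_max _); rewrite rowK.
Qed.

(** Dimension bounds the length of an independent sequence w, wY, wY^2, ...; for the least k with w
    Y^k dependent on the earlier terms, these are a basis of a stable space. *)
Lemma krylov_stable : w != 0 ->
  exists k, [/\ (0 < k)%N, row_free (krylov k) & stablemx (krylov k) Y].
Proof.
move=> w0.
have exk : exists k, (w *m Y ^+ k <= krylov k)%MS.
  apply: contrapT => nok.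
  have : \rank (krylov m.+2) = m.+2.
    elim: (m.+2) => [|k IH]; first by apply/eqP; rewrite -leqn0 rank_leq_row.
    apply/eqP; rewrite eqn_leq rank_leq_row krylov_S -[X in (X < _)%N]IH.
    rewrite ltn_neqAle mxrankS ?addsmxSl // andbT; apply/negP => /eqP rk.
    apply: nok; exists k; have := mxrank_leqif_sup (addsmxSl (krylov k) (w *m Y ^+ k)).
    by case=> _; rewrite rk eqxx => /esym/(submx_trans (addsmxSr _ _)).
  by move=> rk; have := rank_leq_col (krylov m.+2); rewrite rk ltnn.
case: (ex_minnP exk) => k wk kmin.
have freek j : (j <= k)%N -> row_free (krylov j).
  elim: j => [_|j IH jk]; first by rewrite /row_free -leqn0 rank_leq_row.
  rewrite /row_free eqn_leq rank_leq_row krylov_S -[X in (X < _)%N](eqP (IH (ltnW jk))).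
  rewrite ltn_neqAle mxrankS ?addsmxSl // andbT; apply/negP => /eqP rk.
  have := mxrank_leqif_sup (addsmxSl (krylov j) (w *m Y ^+ j)).
  case=> _; rewrite rk eqxx => /esym/(submx_trans (addsmxSr _ _))/kmin.
  by rewrite leqNgt jk.
exists k; split.
- rewrite lt0n; apply: contraNneq w0 => k0; move: wk; rewrite k0 expr0 mulmx1.
  by rewrite -submx0 => /submx_trans; apply; apply/row_subP; case.
- exact: freek.
- apply/row_subP => i; rewrite row_mul rowK -mulmxA -[_ *m Y]/(_ * Y) -exprSr.
  have [ik|ki] := ltnP i.+1 k.
    by apply: submx_trans (row_sub (Ordinal ik) _); rewrite rowK.
  by have -> : i.+1 = k by [apply/eqP; rewrite eqn_leq ki ltn_ord].
Qed.

End Krylov.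

(** * Common eigenvectors on subquotients *)

Section LieTheorem.
Variable F : numClosedFieldType.

(* On the Krylov space of w the element X acts by a triangular matrix with
   diagonal lam X; a bracket [X, Y] acts there with trace 0. *)
Lemma weight_bracket m (S : 'M[F]_m.+1 -> Prop) (lam : 'M[F]_m.+1 -> F)
    (w : 'rV[F]_m.+1) (Y : 'M[F]_m.+1) :
  w != 0 -> (forall X, S X -> w *m X = lam X *: w) ->
  (forall X, S X -> S (lie_bracket X Y)) ->
  forall X, S X -> lam (lie_bracket X Y) = 0.
Proof.
move=> w0 wS SY.
have [k [k0 freeK stabY]] := krylov_stable Y w0.
set K := krylov w Y k in freeK stabY.
have tri i X : S X -> exists c : nat -> F,
    w *m Y ^+ i *m X = lam X *: (w *m Y ^+ i) + \sum_(j < i) c j *: (w *m Y ^+ j).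
  elim: i X => [|i IH] X SX.
    by exists (fun=> 0); rewrite expr0 mulmx1 big_ord0 addr0 wS.
  have [c cE] := IH _ SX; have [d dE] := IH _ (SY _ SX).
  (* Here w Y^(i+1) X = (w Y^i X) Y - w Y^i [X, Y]: multiplication by Y shifts the coefficients c by
     one, and the bracket contributes d and, at index i, its own weight. *)
  exists (fun j => (if j is j'.+1 then c j' else 0)
                   - (if (j < i)%N then d j else lam (lie_bracket X Y))).
  have -> : w *m Y ^+ i.+1 *m X
     = w *m Y ^+ i *m X *m Y - w *m Y ^+ i *m lie_bracket X Y.
    rewrite /lie_bracket mulmxBr !mulmxA opprB addrC subrK.
    by rewrite exprSr -[_ * Y]/(_ *m Y) mulmxA.
  rewrite cE dE mulmxDl -scalemxAl -(mulmxA w) -[_ *m Y]/(_ * Y) -exprSr.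
  rewrite -addrA; congr (_ + _).
  under [RHS]eq_bigr do rewrite scalerBl.
  rewrite sumrB big_ord_recl /= scale0r add0r; congr (_ - _).
    rewrite mulmx_suml; apply: eq_bigr => j _.
    by rewrite -scalemxAl -mulmxA -[_ *m Y]/(_ * Y) -exprSr.
  rewrite big_ord_recr /= ltnn addrC; congr (_ + _).
  by apply: eq_bigr => j _; rewrite ltn_ord.
have stabX X : S X -> stablemx K X.
  move=> SX; apply/row_subP => i; rewrite row_mul rowK.
  have [c ->] := tri i X SX; apply: addmx_sub.
    by apply: scalemx_sub; apply: submx_trans (row_sub i K); rewrite rowK.
  apply: summx_sub => j _; apply: scalemx_sub.
  by apply: submx_trans (row_sub (widen_ord (ltnW (ltn_ord i)) j) K); rewrite rowK.
(* [A X] is the matrix of X on the Krylov space, in the basis of the rows of K. *)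
have [A AE] : exists A, forall X, stablemx K X -> A X *m K = K *m X.
  by exists (fun X => K *m X *m pinvmx K) => X; apply: mulmxKpV.
have trA X : S X -> \tr (A X) = k%:R * lam X.
  move=> SX; rewrite /mxtrace mulr_natl; transitivity (\sum_(i < k) lam X); last first.
    by rewrite sumr_const card_ord.
  apply: eq_bigr => i _; have [c cE] := tri i X SX.
  pose r := \row_(j < k) ((j == i)%:R * lam X + (j < i)%N%:R * c j).
  suff -> : A X i i = r 0 i by rewrite mxE eqxx ltnn mul1r mul0r addr0.
  suff /(row_free_inj freeK) /rowP/(_ i) : row i (A X) *m K = r *m K by rewrite mxE.
  rewrite -row_mul AE ?stabX // row_mul rowK cE [RHS]mulmx_sum_row.
  under [RHS]eq_bigr do rewrite mxE rowK scalerDl.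
  rewrite big_split /=; congr (_ + _).
    rewrite (bigD1 i) //= eqxx mul1r big1 ?addr0 // => j /negPf->.
    by rewrite mul0r scale0r.
  rewrite (bigID (fun j : 'I_k => (j < i)%N)) /= [X in _ + X]big1 ?addr0; last first.
    by move=> j /negPf->; rewrite mul0r scale0r.
  rewrite (big_ord_widen_cond _ xpredT (fun j => c j *: (w *m Y ^+ j)) (ltnW (ltn_ord i))).
  by apply: eq_bigr => j /= ->; rewrite mul1r.
(* The trace of a commutator is 0, and it is also k times the weight; characteristic zero
   concludes. *)
move=> X SX; have := trA _ (SY _ SX).
have -> : A (lie_bracket X Y) = A X *m A Y - A Y *m A X.
  apply: (row_free_inj freeK) => /=; rewrite mulmxBl -!mulmxA.
  rewrite (AE _ (stabX _ SX)) (AE _ stabY) (AE _ (stabX _ (SY _ SX))) !mulmxA.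
  by rewrite (AE _ (stabX _ SX)) (AE _ stabY) mulmxBr !mulmxA.
rewrite raddfB /= mxtrace_mulC subrr => /esym/eqP.
by rewrite mulf_eq0 pnatr_eq0 -leqn0 leqNgt k0 /= => /eqP.
Qed.

(** Induction on the dimension of b. The ideal [a] acts by scalars on the whole Krylov space of one
    of its common eigenvectors, so any eigenvector of Y in that space is common to b. The map [rho]
    allows for the action on a subquotient. *)
Lemma common_eigenvector_solvable n m (rho : {linear 'M[F]_n -> 'M[F]_m.+1})
    (b : {vspace 'M[F]_n}) :
  lie_subalgebra b -> lie_solvable b ->
  {in b &, forall X Y, rho (X *m Y) = rho X *m rho Y} ->
  exists2 u : 'rV[F]_m.+1, u != 0 & forall X, X \in b -> exists c, u *m rho X = c *: u.
Proof.
elim: {b}_.+1 {-2}b (ltnSn (\dim b)) => // d IH b db subb solb rhoM.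
have [b0|b0] := eqVneq b 0%VS.
  exists (delta_mx 0 0).
    by apply/eqP => /matrixP/(_ 0 0)/eqP; rewrite !mxE !eqxx oner_eq0.
  by move=> X; rewrite b0 memv0 => /eqP->; exists 0; rewrite linear0 mulmx0 scale0r.
have [a [Y [ba suba sola dab abY]]] := solvable_hyperplane subb solb b0.
have ab : (a <= b)%VS by rewrite -abY addvSl.
have Yb : Y \in b by rewrite -abY (subvP (addvSr _ _)) ?memv_line.
have [|w w0 wa] := IH a (leq_trans dab db) suba sola.
  by move=> X Z Xa Za; apply: rhoM; apply: (subvP ab).
have [j wj] : exists j, w 0 j != 0.
  apply: contrapT => nj; case/eqP: w0; apply/rowP => j; rewrite mxE.
  by apply: contrapT => /eqP wj; apply: nj; exists j.
(* The weight is read at a nonzero coordinate of w, which makes it a function of the matrix, as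
   [weight_bracket] requires. *)
pose lam (T : 'M[F]_m.+1) := (w *m T) 0 j / w 0 j.
have wlam X : X \in a -> w *m rho X = lam (rho X) *: w.
  by move=> /wa[c E]; rewrite /lam E mxE mulfK.
have rhoB X Z : X \in b -> Z \in b ->
    rho (lie_bracket X Z) = lie_bracket (rho X) (rho Z).
  by move=> Xb Zb; rewrite linearB /= !rhoM.
have aY X : X \in a -> lie_bracket X Y \in a.
  by move=> Xa; apply: (subvP ba); apply: lie_bracket_prod => //; apply: (subvP ab).
have lam0 X : X \in a -> lam (rho (lie_bracket X Y)) = 0.
  move=> Xa; rewrite rhoB //; last exact: (subvP ab).
  apply: (weight_bracket (S := fun T => exists2 X, X \in a & T = rho X) (w := w)) => //.
  - by move=> _ [Z Za ->]; apply: wlam.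
  - move=> _ [Z Za ->]; exists (lie_bracket Z Y); first exact: aY.
    by rewrite rhoB //; apply: (subvP ab).
  - by exists X.
have wYX i X : X \in a -> w *m rho Y ^+ i *m rho X = lam (rho X) *: (w *m rho Y ^+ i).
  elim: i X => [|i IHi] X Xa; first by rewrite expr0 mulmx1 wlam.
  have -> : w *m rho Y ^+ i.+1 *m rho X
     = w *m rho Y ^+ i *m rho X *m rho Y - w *m rho Y ^+ i *m rho (lie_bracket X Y).
    rewrite (rhoB _ _ (subvP ab _ Xa) Yb) /lie_bracket mulmxBr !mulmxA opprB addrC subrK.
    by rewrite exprSr -[_ * rho Y]/(_ *m rho Y) mulmxA.
  rewrite (IHi _ Xa) (IHi _ (aY _ Xa)) lam0 // scale0r subr0 -scalemxAl.
  by rewrite -mulmxA -[_ *m rho Y]/(_ * rho Y) -exprSr.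
have [k [k0 freeK stabY]] := krylov_stable (rho Y) w0.
set K := krylov w (rho Y) k in freeK stabY.
have [A AE] : exists A, A *m K = K *m rho Y.
  by exists (K *m rho Y *m pinvmx K); apply: mulmxKpV.
have [mu /eigenvalueP[x xA x0]] := eigenvalue_closed A k0.
exists (x *m K); first by rewrite mulmx_free_eq0.
move=> X; rewrite -abY => /memv_addP[X1 X1a [X2 /vlineP[t ->] ->]].
exists (lam (rho X1) + t * mu); rewrite linearD linearZ /= mulmxDr scalerDl; congr (_ + _).
  rewrite -mulmxA scalemxAr; congr (_ *m _); apply/row_matrixP => i.
  by rewrite row_mul linearZ /= rowK wYX.
by rewrite -scalemxAr -mulmxA -AE mulmxA xA -!scalemxAl scalerA.
Qed.

(** Lie's theorem on W / U. Let B be a basis of a complement of U in W, and let P read coordinates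
    along B and kill U: the map sending X to B X P is multiplicative because what P discards lies in
    the stable space U. *)
Lemma common_eigenvector_quotient n k p (b : {vspace 'M[F]_n})
    (U : 'M[F]_(k, n)) (W : 'M[F]_(p, n)) :
  lie_subalgebra b -> lie_solvable b ->
  (forall X, X \in b -> stablemx U X) -> (forall X, X \in b -> stablemx W X) ->
  (U < W)%MS ->
  exists v : 'rV[F]_n, [/\ (v <= W)%MS, ~~ (v <= U)%MS &
    forall X, X \in b -> exists c, (v *m X - c *: v <= U)%MS].
Proof.
move=> subb solb stU stW UW.
pose B := row_base (W :\: U)%MS.
have BW : (B <= W)%MS by rewrite eq_row_base diffmxSl.
have BU0 : (B :&: U = 0)%MS.
  by apply/eqP; rewrite -submx0 -(capmx_diff W U); apply: capmxS; rewrite ?eq_row_base.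
have WBU : (W <= B + U)%MS.
  rewrite -(addsmx_diff_cap_eq W U); apply: addsmxS; first by rewrite eq_row_base.
  exact: capmxSr.
have rB : (0 < \rank (W :\: U)%MS)%N.
  rewrite lt0n mxrank_eq0; apply: contraTneq UW => D0; rewrite /ltmx negb_and negbK orbC.
  by apply/orP; left; rewrite (submx_trans WBU) // addsmx_sub eq_row_base D0 sub0mx submx_refl.
have freeB : row_free B by apply: row_base_free.
clearbody B; move: (\rank _) rB B BW BU0 WBU freeB => [//|m] _ B BW BU0 WBU freeB.
have [P BP UP0] : exists2 P : 'M_(n, m.+1), B *m P = 1%:M &
    forall r (x : 'M_(r, n)), (x <= U)%MS -> x *m P = 0.
  have BU0' : (<<B>> :&: <<U>> = 0)%MS by apply/eqP; rewrite -submx0 -BU0 capmxS ?genmxE.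
  exists (proj_mx <<B>>%MS <<U>>%MS *m pinvmx B).
    rewrite mulmxA proj_mx_id ?genmxE //.
    by apply: (row_free_inj freeB); rewrite mulmxKpV ?mul1mx // submx_refl.
  by move=> r x xU; rewrite mulmxA proj_mx_0 ?mul0mx ?genmxE.
have dec r (x : 'M_(r, n)) : (x <= W)%MS -> (x - x *m P *m B <= U)%MS.
  move=> /submx_trans/(_ WBU)/sub_addsmxP[[y z] ->] /=.
  rewrite mulmxDl -(mulmxA y) BP mulmx1 (UP0 _ (z *m U)) ?submxMl //.
  by rewrite addr0 addrAC subrr add0r submxMl.
pose rho := (mulmxr P \o mulmx B) : {linear 'M[F]_n -> 'M[F]_m.+1}.
have [|u u0 uE] := @common_eigenvector_solvable _ _ rho _ subb solb.
  move=> X Y Xb Yb; rewrite /rho /=; apply/eqP; rewrite -subr_eq0 !mulmxA -!mulmxBl.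
  apply/eqP; apply: UP0.
  apply: submx_trans (stU _ Yb); apply: submxMr; apply: dec.
  by apply: submx_trans (stW _ Xb); apply: submxMr.
exists (u *m B); split.
- by rewrite mulmx_sub.
- apply: contra u0 => /UP0; rewrite -mulmxA BP mulmx1 => ->; exact: eqxx.
- move=> X /[dup] Xb /uE[c cE]; exists c.
  rewrite scalemxAl -cE /rho /= !mulmxA; apply: dec.
  by apply: submx_trans (stW _ Xb); apply: submxMr; rewrite mulmx_sub.
Qed.

End LieTheorem.

(** * Borel subalgebras of so(2l+1) *)

Definition upper_mx (F : nmodType) n (T : 'M[F]_n) :=
  forall i j : 'I_n, (j < i)%N -> T i j = 0.

Lemma upper_block_mx (F : nmodType) m n (A : 'M[F]_m) (B : 'M[F]_(m, n)) (D : 'M[F]_n) :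
  upper_mx A -> upper_mx D -> upper_mx (block_mx A B 0 D).
Proof.
move=> uA uD i j; case: (split_ordP i) => i' ->; case: (split_ordP j) => j' -> /=.
- by rewrite block_mxEul; apply: uA.
- by move/ltnW; rewrite leqNgt (leq_trans (ltn_ord i') (leq_addr _ _)).
- by rewrite block_mxEdl mxE.
- by rewrite block_mxEdr ltn_add2l; apply: uD.
Qed.

Section ReversalMatrix.
Variables (F : comUnitRingType) (n : nat).

(* The Gram matrix of beta. *)
Definition revmx : 'M[F]_n := \matrix_(i, j) (j == rev_ord i)%:R.

Lemma mul_revmx m (A : 'M[F]_(n, m)) i j : (revmx *m A) i j = A (rev_ord i) j.
Proof.
rewrite mxE (bigD1 (rev_ord i)) //= mxE eqxx mul1r big1 ?addr0 // => k /negPf ki.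
by rewrite mxE ki mul0r.
Qed.

Lemma tr_revmx : revmx^T = revmx.
Proof.
apply/matrixP => i j; rewrite !mxE; congr (_%:R); congr nat_of_bool.
by rewrite -(inj_eq rev_ord_inj) rev_ordK eq_sym.
Qed.

Lemma mulmx_rev m (A : 'M[F]_(m, n)) i j : (A *m revmx) i j = A i (rev_ord j).
Proof.
rewrite mxE (bigD1 (rev_ord j)) //= mxE rev_ordK eqxx mulr1 big1 ?addr0 // => k kj.
by rewrite mxE -(inj_eq rev_ord_inj) rev_ordK eq_sym (negPf kj) mulr0.
Qed.

Lemma revmxK : revmx *m revmx = 1%:M.
Proof.
apply/matrixP => i j; rewrite mul_revmx !mxE rev_ordK eq_sym.
by congr (_%:R).
Qed.

Lemma revmx_unit : revmx \in unitmx.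
Proof. by have [] := mulmx1_unit revmxK. Qed.

End ReversalMatrix.
Arguments revmx {F n}.

(** * Isotropic flags stable under a solvable algebra *)

Section IsotropicFlag.
Variables (F : numClosedFieldType) (n : nat) (b : {vspace 'M[F]_n}).
Hypothesis subb : lie_subalgebra b.
Hypothesis solb : lie_solvable b.
Hypothesis sob : forall X, X \in b -> X *m revmx = - (revmx *m X^T).

Local Notation orth A := (kermx (revmx *m A^T)).

Lemma sub_orthP m k (A : 'M[F]_(m, n)) (x : 'M_(k, n)) :
  reflect (x *m revmx *m A^T = 0) (x <= orth A)%MS.
Proof. by apply: (iffP sub_kermxP); rewrite mulmxA. Qed.

Lemma rank_orth m (A : 'M[F]_(m, n)) : \rank (orth A) = (n - \rank A)%N.
Proof.
rewrite mxrank_ker -mxrank_tr trmx_mul trmxK mxrankMfree //.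
by rewrite row_free_unit unitmx_tr revmx_unit.
Qed.

Lemma stable_orth m (A : 'M[F]_(m, n)) X :
  X \in b -> stablemx A X -> stablemx (orth A) X.
Proof.
move=> Xb /submxP[T AX]; apply/sub_orthP.
move: (orth A) (sub_orthP _ _ (submx_refl (orth A))) => D D0.
rewrite -(mulmxA D) sob // mulmxN mulNmx -!mulmxA -trmx_mul AX trmx_mul.
by rewrite !mulmxA D0 mul0mx oppr0.
Qed.

Lemma sub_orth_sym m k (A : 'M[F]_(m, n)) (B : 'M[F]_(k, n)) :
  (A <= orth B)%MS -> (B <= orth A)%MS.
Proof.
move=> /sub_orthP AB; apply/sub_orthP; apply: trmx_inj.
by rewrite !trmx_mul trmxK tr_revmx trmx0 mulmxA.
Qed.

Definition stable_mod k (A : 'M[F]_(k, n)) (v : 'rV[F]_n) :=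
  forall X, X \in b -> exists c, (v *m X - c *: v <= A)%MS.

(** An eigenvector v in A^perp / A may be anisotropic; a second one v' is then taken in the
    orthogonal of v. If v' is anisotropic too, both have eigenvalue 0, because elements of b are
    skew, so every combination of v and v' is killed modulo A, and one not in A is isotropic. *)
Lemma isotropic_line_mod k (A : 'M[F]_(k, n)) :
  (forall X, X \in b -> stablemx A X) -> (A <= orth A)%MS -> ((\rank A).*2.+2 < n)%N ->
  exists v, [/\ (v <= orth A)%MS, ~~ (v <= A)%MS, (v <= orth v)%MS & stable_mod A v].
Proof.
move=> stA isoA rA.
have stO X : X \in b -> stablemx (orth A) X by move=> Xb; apply: stable_orth (stA X Xb).
have [|v [vA vNA vst]] := common_eigenvector_quotient subb solb stA stO.
  rewrite ltmxErank isoA rank_orth; move: rA; rewrite -addnn; lia.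
have [vv|vv] := boolP (v <= orth v)%MS; first by exists v.
pose q (x y : 'rV[F]_n) := (x *m revmx *m y^T) 0 0.
have qE x y : reflect (q x y = 0) (x <= orth y)%MS.
  apply: (iffP (sub_orthP _ _)) => [|q0]; first by rewrite /q => ->; rewrite mxE.
  by apply/matrixP => i j; rewrite !ord1 [RHS]mxE.
have qDl x y z : q (x + y) z = q x z + q y z by rewrite /q !mulmxDl mxE.
have qZl c x y : q (c *: x) y = c * q x y by rewrite /q -!scalemxAl mxE.
have qC x y : q x y = q y x.
  rewrite /q; have -> : x *m revmx *m y^T = (y *m revmx *m x^T)^T; last by rewrite mxE.
  by rewrite !trmx_mul trmxK tr_revmx mulmxA.
have qX x X : X \in b -> q (x *m X) x = 0.
  move=> Xb; suff : q (x *m X) x = - q (x *m X) x.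
    by move/eqP; rewrite -addr_eq0 -mulr2n mulrn_eq0 => /eqP.
  rewrite [in RHS]qC /q -(mulmxA x) sob // mulmxN mulNmx mxE.
  by rewrite -!mulmxA -trmx_mul.
pose D := (orth A :&: orth v)%MS.
have Av : (A <= orth v)%MS by exact: sub_orth_sym.
have stD X : X \in b -> stablemx D X.
  move=> Xb; rewrite sub_capmx; apply/andP; split.
    by apply: submx_trans (stable_orth Xb (stA X Xb)); apply: submxMr; apply: capmxSl.
  have [c /submxP[T vX]] := vst X Xb; apply/sub_orthP.
  move: D (sub_orthP _ _ (capmxSr _ _) : D *m _ *m v^T = 0)
    (sub_orthP _ _ (capmxSl _ _) : D *m _ *m A^T = 0) => D' Dv DA.
  rewrite -(mulmxA D') sob // mulmxN mulNmx -!mulmxA -trmx_mul.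
  have -> : v *m X = c *: v + T *m A by rewrite -vX addrC subrK.
  rewrite linearD linearZ /= trmx_mul !mulmxDr -!scalemxAr !mulmxA.
  by rewrite Dv DA mul0mx scaler0 addr0 oppr0.
have [|v' [v'D v'NA v'st]] := common_eigenvector_quotient subb solb stA stD.
  rewrite ltmxErank sub_capmx isoA Av /=.
  have := mxrank_sum_cap (orth A) (orth v); rewrite !rank_orth => rD.
  have rv : (\rank v <= 1)%N by apply: rank_leq_row.
  have rs : (\rank (orth A + orth v)%MS <= n)%N by apply: rank_leq_col.
  move: rA rD; rewrite -addnn /D; lia.
have v'A : (v' <= orth A)%MS by apply: submx_trans v'D (capmxSl _ _).
have [vv'|vv'] := boolP (v' <= orth v')%MS; first by exists v'.
have kill x : (x <= orth A)%MS -> ~~ (x <= orth x)%MS -> stable_mod A x ->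
    forall X, X \in b -> (x *m X <= A)%MS.
  move=> xA xx xst X Xb; have [c cA] := xst X Xb.
  suff c0 : c = 0 by move: cA; rewrite c0 scale0r subr0.
  have /qE : (x *m X - c *: x <= orth x)%MS.
    by apply: submx_trans cA _; apply: sub_orth_sym.
  rewrite qDl -scaleNr qZl qX // add0r mulNr => /eqP; rewrite oppr_eq0 mulf_eq0.
  by case/orP => [/eqP//|/eqP/qE]; rewrite (negPf xx).
have qvv : q v v != 0 by apply: contraNneq vv => /qE.
have qvv' : q v' v' != 0 by apply: contraNneq vv' => /qE.
have q0 : q v' v = 0 by apply/qE; apply: submx_trans v'D (capmxSr _ _).
(* A root of q v v + s^2 q v' v' = 0. *)
pose s := sqrtC (- q v v / q v' v').
exists (v + s *: v'); split.
- by rewrite addmx_sub ?scalemx_sub.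
- apply: contra qvv => uA; have /qE : ((v + s *: v')%R <= orth v)%MS.
    by apply: submx_trans uA Av.
  by rewrite qDl qZl q0 mulr0 addr0 => ->.
- apply/qE; rewrite qDl qZl qC qDl qZl q0 mulr0 addr0 [q v' _]qC qDl qZl [q v v']qC q0 add0r.
  by rewrite mulrA -expr2 sqrtCK divfK // subrr.
- move=> X Xb; exists 0; rewrite scale0r subr0 mulmxDl -scalemxAl addmx_sub ?scalemx_sub //.
    exact: kill vst _ Xb.
  exact: kill v'st _ Xb.
Qed.

(** Each new vector is placed on top, so the flag is spanned by the last rows and X acts on the rows
    by an upper triangular matrix. *)
Lemma stable_isotropic_flag k : (k.*2 < n)%N ->
  exists A : 'M[F]_(k, n), [/\ row_free A, (A <= orth A)%MS &
    forall X, X \in b -> exists2 T, upper_mx T & A *m X = T *m A].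
Proof.
elim: k => [_|k IH]; first last.
  rewrite doubleS => kn; have [|A [freeA isoA stA]] := IH.
    by apply: leq_trans kn; rewrite ltnS leqW.
  have [|||v [vA vNA vv vst]] := @isotropic_line_mod k A.
  - by move=> X /stA[T _ ->]; apply: submxMl.
  - exact: isoA.
  - by rewrite (eqP freeA).
  exists (col_mx v A : 'M_(1 + k, n)); split.
  - suff: (k < \rank (col_mx v A))%N by rewrite /row_free eqn_leq rank_leq_row.
    rewrite -[X in (X < _)%N](eqP freeA) -addsmxE.
    rewrite ltn_neqAle mxrankS ?addsmxSr // andbT; apply: contra vNA => /eqP rk.
    have := mxrank_leqif_sup (addsmxSr v A).
    by case=> _; rewrite -rk eqxx => /esym/(submx_trans (addsmxSl _ _)).
  - apply/sub_orthP; suff: col_mx v A *m revmx *m (col_mx v A)^T = 0 by [].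
    rewrite mul_col_mx tr_col_mx mul_mx_row !mul_col_mx.
    rewrite (sub_orthP _ _ vv) (sub_orthP _ _ vA) (sub_orthP _ _ (sub_orth_sym vA)).
    by rewrite (sub_orthP _ _ isoA) !col_mx0 row_mx0.
  move=> X Xb; have [T trT AX] := stA X Xb; have [c /submxP[t vX]] := vst X Xb.
  exists (block_mx c%:M t 0 T : 'M_(1 + k)).
    by apply: (@upper_block_mx F 1 k) => // i j; rewrite !ord1.
  suff: col_mx v A *m X = block_mx c%:M t 0 T *m col_mx v A by [].
  by rewrite mul_col_mx mul_block_col AX mul0mx add0r mul_scalar_mx -vX addrC subrK.
exists 0; split.
- by rewrite /row_free -leqn0 rank_leq_row.
- by apply/row_subP; case.
- by move=> X _; exists 0; [case | apply/matrixP; case].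
Qed.

End IsotropicFlag.

(** * Indices of the basis vectors *)

Section Indices.
Variable l : nat.
Notation N := l.*2.+1.

Lemma leq_double_succ : (l <= N)%N.
Proof. by rewrite -addnn; lia. Qed.

(* lo k, mid and hi k are the indices of e_{k+1}, e_0 and e_{-(k+1)}. *)
Definition lo (k : 'I_l) : 'I_N := widen_ord leq_double_succ k.
Definition hi (k : 'I_l) : 'I_N := rev_ord (lo k).
Definition mid : 'I_N := inord l.

Lemma val_mid : mid = l :> nat.
Proof. by rewrite inordK // -addnn; lia. Qed.

Lemma rev_mid : rev_ord mid = mid.
Proof. by apply/val_inj; rewrite /= val_mid -addnn; lia. Qed.

Lemma rev_hi k : rev_ord (hi k) = lo k.
Proof. exact: rev_ordK. Qed.

Lemma lo_inj : injective lo.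
Proof. by move=> i j /(congr1 val) /= /val_inj. Qed.

Lemma hi_inj : injective hi.
Proof. by move=> i j /rev_ord_inj/lo_inj. Qed.

Lemma lo_neq_mid k : (lo k == mid) = false.
Proof. by rewrite -val_eqE /= val_mid; have := ltn_ord k; lia. Qed.

Lemma hi_neq_mid k : (hi k == mid) = false.
Proof. by rewrite -val_eqE /= val_mid -addnn; have := ltn_ord k; lia. Qed.

Lemma lo_neq_hi k k' : (lo k == hi k') = false.
Proof. by rewrite -val_eqE /= -addnn; have := ltn_ord k; have := ltn_ord k'; lia. Qed.

Variant idx_spec : 'I_N -> Type :=
  | IdxLo k : idx_spec (lo k)
  | IdxMid : idx_spec mid
  | IdxHi k : idx_spec (hi k).

Lemma idxP i : idx_spec i.
Proof.
have [il|li|il] := ltngtP i l.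
- by have -> : i = lo (Ordinal il) by [apply/val_inj]; constructor.
- have ri : (rev_ord i < l)%N by move: (ltn_ord i) li => /=; lia.
  have -> : i = hi (Ordinal ri) by apply: rev_ord_inj; rewrite rev_hi; apply/val_inj.
  by constructor.
- by have -> : i = mid by [apply/val_inj; rewrite /= val_mid]; constructor.
Qed.

Definition frame (T : Type) (a b : 'I_l -> T) (c : T) (j : 'I_N) : T :=
  if insub (val j) is Some k then a k
  else if insub (val (rev_ord j)) is Some k then b k else c.

Lemma frame_lo T (a b : 'I_l -> T) c k : frame a b c (lo k) = a k.
Proof.
rewrite /frame /= (insubT (fun j => j < l)%N (ltn_ord k)) /=.
by congr a; apply/val_inj.
Qed.

Lemma frame_hi T (a b : 'I_l -> T) c k : frame a b c (hi k) = b k.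
Proof.
rewrite /frame insubF ?rev_hi /=; last by rewrite -addnn; have := ltn_ord k; lia.
by rewrite (insubT (fun j => j < l)%N (ltn_ord k)) /=; congr b; apply/val_inj.
Qed.

Lemma frame_mid T (a b : 'I_l -> T) c : frame a b c mid = c.
Proof. by rewrite /frame rev_mid !insubF // [val _]/= val_mid ltnn. Qed.

End Indices.
Arguments mid {l}.

Lemma revmx_lo (F : comUnitRingType) l (i : 'I_l) j : (revmx (lo i) j : F) = (j == hi i)%:R.
Proof. by rewrite mxE. Qed.

Lemma revmx_hi (F : comUnitRingType) l (i : 'I_l) j : (revmx (hi i) j : F) = (j == lo i)%:R.
Proof. by rewrite mxE rev_hi. Qed.

Lemma revmx_mid (F : comUnitRingType) l j : (revmx (mid : 'I_l.*2.+1) j : F) = (j == mid)%:R.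
Proof. by rewrite mxE rev_mid. Qed.

(** * Witt's theorem for maximal isotropic subspaces *)

Section WittExtension.
Variables (F : numClosedFieldType) (l : nat).
Notation N := l.*2.+1.

Definition orthogonal_mx n (g : 'M[F]_n) := g^T *m revmx *m g = revmx.

Lemma orthogonal_unit n (g : 'M[F]_n) : orthogonal_mx g -> g \in unitmx.
Proof.
move=> og; have : revmx *m (g^T *m revmx) *m g = 1%:M by rewrite -mulmxA og revmxK.
by case/mulmx1_unit.
Qed.

Lemma invmx_orthogonal n (g : 'M[F]_n) : orthogonal_mx g -> invmx g = revmx *m g^T *m revmx.
Proof.
move=> og; have ug := orthogonal_unit og; apply: (row_free_inj (A := g)).
  by rewrite row_free_unit.
by rewrite mulVmx // -!mulmxA (mulmxA g^T) og revmxK.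
Qed.

Lemma orthogonalM n (g h : 'M[F]_n) :
  orthogonal_mx g -> orthogonal_mx h -> orthogonal_mx (g *m h).
Proof.
move=> og oh; rewrite /orthogonal_mx trmx_mul -mulmxA -(mulmxA _ g^T) !mulmxA.
by rewrite -(mulmxA h^T) -(mulmxA h^T) og.
Qed.

Lemma orthogonalV n (g : 'M[F]_n) : orthogonal_mx g -> orthogonal_mx (invmx g).
Proof.
move=> og; have ug := orthogonal_unit og; rewrite /orthogonal_mx -[in LHS]og.
by rewrite !mulmxA -trmx_mul mulmxV // trmx1 mul1mx -mulmxA mulmxV ?mulmx1.
Qed.

Lemma orthogonal_det n (g : 'M[F]_n) : orthogonal_mx g -> \det g = 1 \/ \det g = -1.
Proof.
move=> /(congr1 determinant); rewrite !det_mulmx det_tr mulrAC -expr2 => dg.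
have : \det g ^+ 2 == 1.
  have d0 : \det (revmx : 'M[F]_n) != 0 by rewrite -unitfE -unitmxE revmx_unit.
  by rewrite -(inj_eq (mulIf d0)) mul1r dg.
by rewrite sqrf_eq1 => /orP[] /eqP; [left|right].
Qed.

Lemma gramE n (g : 'M[F]_n) i j :
  (g^T *m revmx *m g) i j = ((col i g)^T *m revmx *m col j g) 0 0.
Proof. by rewrite tr_col -row_mul (colE j) mulmxA -row_mul -colE !mxE. Qed.

Lemma dual_isotropic (A : 'M[F]_(N, l)) :
  A^T *m revmx *m A = 0 -> row_free A^T ->
  exists B, A^T *m revmx *m B = 1%:M /\ B^T *m revmx *m B = 0.
Proof.
move=> isoA freeA.
have /row_freeP[B0 AB0] : row_free (A^T *m revmx).
  by rewrite /row_free mxrankMfree // row_free_unit revmx_unit.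
have B0A : B0^T *m revmx *m A = 1%:M.
  by apply: trmx_inj; rewrite !trmx_mul trmxK tr_revmx mulmxA AB0 trmx1.
pose M := B0^T *m revmx *m B0.
have trM : M^T = M by rewrite /M !trmx_mul trmxK tr_revmx mulmxA.
exists (B0 - A *m (2^-1 *: M)); split.
  by rewrite mulmxBr AB0 mulmxA isoA mul0mx subr0.
rewrite [(B0 - _)^T]linearB /= trmx_mul [(_ *: _)^T]linearZ /= trM mulmxBl mulmxBl !mulmxBr -/M.
rewrite -!(mulmxA (2^-1 *: M)) AB0 mulmx1 (mulmxA _ A) B0A mul1mx (mulmxA _ A) isoA.
rewrite mul0mx mulmx0 subr0 -addrA -opprD -scalerDl.
by rewrite -mulr2n -[_^-1 *+ _]mulr_natr mulVf ?pnatr_eq0 // scale1r subrr.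
Qed.

(** The 2l columns of A and B leave room for a nonzero vector orthogonal to them. Were it isotropic,
    it would be orthogonal to a basis of the whole space. A square root normalizes it. *)
Lemma anisotropic_vector (A B : 'M[F]_(N, l)) :
  A^T *m revmx *m A = 0 -> A^T *m revmx *m B = 1%:M -> B^T *m revmx *m B = 0 ->
  exists c : 'cV[F]_N, [/\ A^T *m revmx *m c = 0, B^T *m revmx *m c = 0 &
    (c^T *m revmx *m c) 0 0 = 1].
Proof.
move=> isoA AB isoB.
have BA : B^T *m revmx *m A = 1%:M.
  by apply: trmx_inj; rewrite !trmx_mul trmxK tr_revmx mulmxA AB trmx1.
have [c0 c0n cK] : exists2 c : 'rV[F]_N, c != 0 &
    (c <= kermx (row_mx (revmx *m A) (revmx *m B)))%MS.
  have : kermx (row_mx (revmx *m A) (revmx *m B)) != 0.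
    rewrite kermx_eq0 /row_free neq_ltn.
    by rewrite (leq_ltn_trans (rank_leq_col _)) // addnn.
  by move=> /rowV0Pn[c cK c0]; exists c.
move: cK; rewrite sub_kermx mul_mx_row !mulmxA row_mx_eq0 => /andP[/eqP cA /eqP cB].
have Ac : A^T *m revmx *m c0^T = 0.
  by apply: trmx_inj; rewrite !trmx_mul !trmxK tr_revmx mulmxA cA trmx0.
have Bc : B^T *m revmx *m c0^T = 0.
  by apply: trmx_inj; rewrite !trmx_mul !trmxK tr_revmx mulmxA cB trmx0.
pose q := (c0 *m revmx *m c0^T) 0 0.
have q0 : q != 0.
  apply: contraNneq (c0n) => q0.
  have cc : c0 *m revmx *m c0^T = 0 by apply/matrixP => i j; rewrite !ord1 [RHS]mxE.
  pose G := col_mx A^T (col_mx B^T c0).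
  have freeG : row_free G.
    apply: inj_row_free => v; rewrite /G -[v]hsubmxK -[rsubmx v]hsubmxK.
    move: (lsubmx v) (lsubmx (rsubmx v)) (rsubmx (rsubmx v)) => x y z.
    rewrite !mul_row_col => xyz.
    have x0 : x = 0.
      move/(congr1 (mulmxr (revmx *m B))): (xyz); rewrite /= mul0mx !mulmxDl -!mulmxA.
      by rewrite !(mulmxA _ revmx) AB isoB cB !mulmx0 !addr0 mulmx1.
    have y0 : y = 0.
      move/(congr1 (mulmxr (revmx *m A))): (xyz); rewrite /= mul0mx !mulmxDl -!mulmxA.
      by rewrite !(mulmxA _ revmx) isoA BA cA !mulmx0 add0r !addr0 mulmx1.
    move: xyz; rewrite x0 y0 !mul0mx !add0r [z]mx11_scalar mul_scalar_mx => /eqP.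
    by rewrite scaler_eq0 (negPf c0n) orbF => /eqP->; rewrite raddf0 !row_mx0.
  have {freeG} : row_free (G^T).
    by rewrite /row_free mxrank_tr (eqP freeG) addn1 addnS addnn.
  move=> freeG; have := @row_free_inj _ 1 _ _ _ freeG (c0 *m revmx) 0.
  rewrite mul0mx !tr_col_mx !trmxK !mul_mx_row.
  rewrite cA cB cc !row_mx0 => /(_ erefl) /(congr1 (mulmxr revmx)).
  by rewrite /= -mulmxA revmxK mulmx1 mul0mx => ->.
exists ((sqrtC q)^-1 *: c0^T); split; rewrite ?linearZ /= -?scalemxAr ?Ac ?Bc ?scaler0 //.
by rewrite trmxK -!scalemxAl 2!mxE -/q mulrA -invfM -expr2 sqrtCK mulVf.
Qed.

Lemma witt_extension (A : 'M[F]_(N, l)) :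
  A^T *m revmx *m A = 0 -> row_free A^T ->
  exists g, [/\ orthogonal_mx g, \det g = 1 & forall k, col (lo k) g = col k A].
Proof.
move=> isoA freeA; have [B [AB isoB]] := dual_isotropic isoA freeA.
have [c [Ac Bc cc]] := anisotropic_vector isoA AB isoB.
have BA : B^T *m revmx *m A = 1%:M.
  by apply: trmx_inj; rewrite !trmx_mul trmxK tr_revmx mulmxA AB trmx1.
have cA : c^T *m revmx *m A = 0.
  by apply: trmx_inj; rewrite !trmx_mul trmxK tr_revmx mulmxA Ac trmx0.
have cB : c^T *m revmx *m B = 0.
  by apply: trmx_inj; rewrite !trmx_mul trmxK tr_revmx mulmxA Bc trmx0.
pose g : 'M[F]_N := \matrix_(i, j) frame (fun k => A i k) (fun k => B i k) (c i 0) j.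
have glo k : col (lo k) g = col k A by apply/colP => i; rewrite !mxE frame_lo.
have ghi k : col (hi k) g = col k B by apply/colP => i; rewrite !mxE frame_hi.
have gmid : col mid g = c by apply/colP => i; rewrite !mxE frame_mid.
have og : orthogonal_mx g.
  have colD (X Y : 'M[F]_(N, l)) i j :
      ((col i X)^T *m revmx *m col j Y) 0 0 = (X^T *m revmx *m Y) i j.
    by rewrite tr_col -row_mul (colE j) mulmxA -row_mul -colE !mxE.
  have colC (X : 'M[F]_(N, l)) i : ((col i X)^T *m revmx *m c) 0 0 = (X^T *m revmx *m c) i 0.
    by rewrite tr_col -!row_mul mxE.
  have colC' (X : 'M[F]_(N, l)) i : (c^T *m revmx *m col i X) 0 0 = (c^T *m revmx *m X) 0 i.
    by rewrite colE mulmxA -colE mxE.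
  apply/matrixP => i j; rewrite gramE; case: (idxP i) => [k||k]; case: (idxP j) => [k'||k'];
    rewrite ?glo ?ghi ?gmid ?colD ?colC ?colC' ?AB ?BA ?isoA ?isoB ?Ac ?Bc ?cA ?cB ?cc
      ?revmx_lo ?revmx_hi ?revmx_mid ?lo_neq_hi ?lo_neq_mid ?hi_neq_mid ?eqxx ?mxE //.
  - by rewrite eq_sym hi_neq_mid.
  - by rewrite (inj_eq (@hi_inj _)) eq_sym.
  - by rewrite (inj_eq (@lo_inj _)) eq_sym.
  - by rewrite eq_sym lo_neq_mid.
  - by rewrite eq_sym lo_neq_hi.
have [dg|dg] := orthogonal_det og; first by exists g.
(* A determinant -1 is corrected by changing the sign of the image of e_0, which is not among the
   prescribed columns. *)
pose d : 'rV[F]_N := \row_j (if j == mid then -1 else 1).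
have dE j : d 0 (rev_ord j) = d 0 j.
  by rewrite !mxE -(inj_eq rev_ord_inj) rev_ordK rev_mid.
have od : orthogonal_mx (diag_mx d).
  apply/matrixP => i j; rewrite tr_diag_mx mul_mx_diag mxE mul_diag_mx mxE [revmx _ _]mxE.
  have [->|_] := eqVneq j (rev_ord i); last by rewrite mulr0 mul0r.
  by rewrite dE mulr1 mxE; case: ifP; rewrite ?mulrNN mulr1.
exists (g *m diag_mx d); split; first exact: orthogonalM.
  rewrite det_mulmx dg det_diag (bigD1 mid) //= big1 => [|i /negPf mi].
    by rewrite mxE eqxx mulr1 mulrNN mulr1.
  by rewrite mxE mi.
move=> k; rewrite -glo; apply/colP => i.
by rewrite mul_mx_diag !mxE lo_neq_mid mulr1.
Qed.

End WittExtension.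

(** * Upper triangular matrices, orthogonal and skew *)

Section UpperTriangular.
Variables (F : numClosedFieldType) (n : nat).
Implicit Types (S T X g : 'M[F]_n).

Lemma upper_mx1 : upper_mx (1%:M : 'M[F]_n).
Proof. by move=> i j ji; rewrite mxE -val_eqE gtn_eqF. Qed.

Lemma upper_mxM S T : upper_mx S -> upper_mx T -> upper_mx (S *m T).
Proof.
move=> uS uT i j ji; rewrite mxE big1 // => k _.
by have [ki|ik] := ltnP k i; [rewrite uS ?mul0r | rewrite uT ?mulr0 // (leq_trans ji)].
Qed.

Lemma upper_mxB S T : upper_mx S -> upper_mx T -> upper_mx (S - T).
Proof. by move=> uS uT i j ji; rewrite !mxE uS // uT // subr0. Qed.

Lemma det_upper T : upper_mx T -> \det T = \prod_i T i i.
Proof.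
move=> uT; rewrite -det_tr det_trig; first by apply: eq_bigr => i _; rewrite mxE.
by apply/is_trig_mxP => i j ij; rewrite mxE uT.
Qed.

Lemma upper_unit_diag T i : upper_mx T -> T \in unitmx -> T i i != 0.
Proof. by move=> /det_upper dT; rewrite unitmxE unitfE dT => /prodf_neq0; apply. Qed.

Lemma upper_mxV T : upper_mx T -> T \in unitmx -> upper_mx (invmx T).
Proof.
move=> uT Tu i j; have [d] := ubnP (n - i)%N; elim: d i => // d IH i nid ji.
have := congr1 (fun X : 'M_n => X i j) (mulmxV Tu).
rewrite /= !mxE -val_eqE gtn_eqF // (bigD1 i) //= big1 => [|k ki].
  move/eqP; rewrite addr0 mulf_eq0 (negPf (upper_unit_diag i uT Tu)) => /eqP//.
have [lt_ki|le_ik] := ltnP k i; first by rewrite uT ?mul0r.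
have lt_ik : (i < k)%N by rewrite ltn_neqAle eq_sym ki.
by rewrite IH ?mulr0 ?(ltn_trans ji) //; have := ltn_ord k; lia.
Qed.

Definition so_mx X := X^T *m revmx + revmx *m X = 0.

Lemma so_mxE X : so_mx X <-> forall i j, X i j = - X (rev_ord j) (rev_ord i).
Proof.
split=> [soX i j|soX].
  move/matrixP/(_ j (rev_ord i)): soX; rewrite mxE mulmx_rev mul_revmx !mxE rev_ordK.
  by move/eqP; rewrite addr_eq0 => /eqP.
apply/matrixP => i j; rewrite mxE mulmx_rev mul_revmx !mxE (soX (rev_ord j)) !rev_ordK.
by rewrite addrC subrr.
Qed.

(** The inverse is the reflection of g in the antidiagonal, which exchanges no entry below the
    diagonal with one above. *)
Lemma upper_orthogonalV g : orthogonal_mx g -> upper_mx g -> upper_mx (invmx g).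
Proof.
move=> og ug i j ji; rewrite invmx_orthogonal // mulmx_rev mul_revmx mxE ug //=.
by have := ltn_ord i; lia.
Qed.

Lemma upper_orthogonal_diag g i : orthogonal_mx g -> upper_mx g ->
  g i i * g (rev_ord i) (rev_ord i) = 1.
Proof.
move=> og ug; have uV := upper_orthogonalV og ug.
have := congr1 (fun X : 'M_n => X i i) (mulmxV (orthogonal_unit og)).
rewrite /= !mxE eqxx (bigD1 i) //= big1 ?addr0 => [|k ki].
  by rewrite invmx_orthogonal // mulmx_rev mul_revmx mxE.
have [lt_ki|le_ik] := ltnP k i; first by rewrite ug ?mul0r.
by rewrite uV ?mulr0 // ltn_neqAle eq_sym ki.
Qed.

Lemma so_mx_conj g X : orthogonal_mx g -> so_mx X -> so_mx (g *m X *m invmx g).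
Proof.
move=> og; have gu := orthogonal_unit og; rewrite /so_mx => soX.
have ogV : (invmx g)^T *m revmx = revmx *m g.
  rewrite invmx_orthogonal // !trmx_mul trmxK tr_revmx -!mulmxA.
  by rewrite revmxK mulmx1.
have ogT : g^T *m revmx = revmx *m invmx g.
  by rewrite invmx_orthogonal // !mulmxA revmxK mul1mx.
rewrite !trmx_mul -!mulmxA ogT (mulmxA revmx g) -ogV -!mulmxA -mulmxDr !mulmxA -mulmxDl.
by rewrite soX mul0mx mulmx0.
Qed.

End UpperTriangular.

(** * The algebra of upper triangular elements of so *)

Section StandardBorel.
Variables (F : numClosedFieldType) (n : nat).
Implicit Types (X g : 'M[F]_n).

Definition strict_lower X : 'M[F]_n := \matrix_(i, j) (if (j < i)%N then X i j else 0).

Fact strict_lower_linear : linear strict_lower.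
Proof.
move=> c X Y; apply/matrixP => i j; rewrite !mxE.
by case: ifP => _; rewrite ?mulr0 ?addr0.
Qed.
HB.instance Definition _ := GRing.isLinear.Build F _ _ _ strict_lower strict_lower_linear.

Definition so_defect X : 'M[F]_n := X^T *m revmx + revmx *m X.

Fact so_defect_linear : linear so_defect.
Proof.
move=> c X Y; rewrite /so_defect linearP /= mulmxDl mulmxDr -scalemxAl -scalemxAr.
by rewrite scalerDr addrACA.
Qed.
HB.instance Definition _ := GRing.isLinear.Build F _ _ _ so_defect so_defect_linear.

(** An intersection of two kernels, since a [{vspace}] is wanted rather than a predicate. *)
Definition std_borel : {vspace 'M[F]_n} :=
  (lker (linfun so_defect) :&: lker (linfun strict_lower))%VS.

Lemma mem_std_borel X : X \in std_borel <-> so_mx X /\ upper_mx X.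
Proof.
rewrite memv_cap !memv_ker !lfunE /=; split.
  move=> /andP[/eqP soX /eqP lX]; split=> // i j ji.
  by move/matrixP/(_ i j): lX; rewrite !mxE ji.
move=> [soX uX]; apply/andP; split; first exact/eqP.
by apply/eqP/matrixP => i j; rewrite !mxE; case: ifP => // /uX.
Qed.

Lemma mem_Ad g b X : g \in unitmx -> (X \in Ad g b) = (invmx g *m X *m g \in b).
Proof.
move=> gu; apply/idP/idP => [/memv_imgP[Y Yb ->]|Xb].
  by rewrite lfunE /= !mulmxA mulVmx // mul1mx mulmxKV.
apply/memv_imgP; exists (invmx g *m X *m g) => //.
by rewrite lfunE /= !mulmxA mulmxV // mul1mx mulmxK.
Qed.

Lemma dim_Ad g b : g \in unitmx -> \dim (Ad g b) = \dim b.
Proof.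
move=> gu; apply: limg_dim_eq; apply/eqP; rewrite -subv0; apply/subvP => X.
rewrite memv_cap memv_ker lfunE /= => /andP[_ /eqP /(congr1 (fun Y => invmx g *m Y *m g))].
by rewrite mulmx0 mul0mx !mulmxA mulVmx // mul1mx mulmxKV // memv0 => ->.
Qed.

Lemma invmx_mul g h : g \in unitmx -> h \in unitmx ->
  invmx (g *m h) = invmx h *m invmx g.
Proof.
move=> gu hu; apply: (row_free_inj (A := g *m h)).
  by rewrite row_free_unit unitmx_mul gu.
by rewrite mulVmx ?unitmx_mul ?gu // -mulmxA mulKmx // mulVmx.
Qed.

Lemma AdM g h b : g \in unitmx -> h \in unitmx -> Ad (g *m h) b = Ad g (Ad h b).
Proof.
move=> gu hu; apply/vspaceP => X; rewrite !mem_Ad ?unitmx_mul ?gu //.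
by rewrite invmx_mul // !mulmxA.
Qed.

Lemma lie_prod_ind (P : 'M[F]_n -> Prop) (U V : {vspace 'M[F]_n}) :
  P 0 -> (forall c X Y, P X -> P Y -> P (c *: X + Y)) ->
  (forall X Y, X \in U -> Y \in V -> P (lie_bracket X Y)) ->
  forall Z, Z \in lie_prod U V -> P Z.
Proof.
move=> P0 Plin PUV Z; rewrite /lie_prod; set s := (X in <<X>>%VS).
move=> /(@coord_span _ _ _ (in_tuple s)) ->.
apply: (big_ind P) => // [X Y PX PY|i _].
  by rewrite -[X]scale1r; apply: Plin.
rewrite -[_ *: _]addr0; apply: Plin => //.
have /allpairsP[[X Y] [XU YV ->]] : (in_tuple s)`_i \in s by rewrite mem_nth.
by apply: PUV; apply: vbasis_mem.
Qed.

(* For k = 0 the bracket kills the main diagonal; for k > 0 its entries even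
   vanish for j < i + 2k. *)
Lemma derived_std_borel g k X : g \in unitmx ->
  X \in derived_series (Ad g std_borel) k ->
  forall i j : 'I_n, (j < i + k)%N -> (invmx g *m X *m g) i j = 0.
Proof.
move=> gu; elim: k X => [|k IH] X /=.
  rewrite mem_Ad // => /mem_std_borel[_ uX] i j.
  by rewrite addn0; apply: uX.
apply: (lie_prod_ind (P := fun X => forall i j : 'I_n,
  (j < i + k.+1)%N -> (invmx g *m X *m g) i j = 0)).
- by move=> i j _; rewrite mulmx0 mul0mx mxE.
- move=> c Y Z PY PZ i j ij; rewrite mulmxDr mulmxDl -scalemxAr -scalemxAl.
  by rewrite mxE [X in X + _]mxE PY // PZ // mulr0 addr0.
move=> Y Z /IH PY /IH PZ i j ij.
have -> : invmx g *m lie_bracket Y Z *m g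
    = lie_bracket (invmx g *m Y *m g) (invmx g *m Z *m g).
  rewrite /lie_bracket mulmxBr mulmxBl !mulmxA.
  by rewrite -!(mulmxA _ g (invmx g)) mulmxV // !mulmx1.
move: (invmx g *m Y *m g) (invmx g *m Z *m g) PY PZ => {}Y {}Z PY PZ.
rewrite /lie_bracket mxE [X in _ + X]mxE; apply/eqP; rewrite subr_eq0; apply/eqP.
rewrite !mxE; apply: eq_bigr => m _.
have [mk|km] := ltnP m (i + k); first by rewrite [Y i m]PY // [Z i m]PZ // !mul0r.
have [jm|mj] := ltnP j (m + k); first by rewrite [Z m j]PZ // [Y m j]PY // !mulr0.
suff [<- <-] : i = m /\ m = j by rewrite mulrC.
by split; apply/val_inj => /=; lia.
Qed.

Definition so_set : set 'M[F]_n := [set X | so_mx X]%classic.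

Lemma Ad_std_borel_solvable g : orthogonal_mx g ->
  solvable_subalgebra so_set (Ad g std_borel).
Proof.
move=> og; have gu := orthogonal_unit og.
have conjE X : X = g *m (invmx g *m X *m g) *m invmx g.
  by rewrite !mulmxA mulmxV // mul1mx mulmxK.
split.
- move=> X /=; rewrite mem_Ad // => /mem_std_borel[soX _].
  by rewrite /so_set /= (conjE X); apply: so_mx_conj.
- move=> X Y; rewrite !mem_Ad // => /mem_std_borel[soX uX] /mem_std_borel[soY uY].
  have -> : invmx g *m lie_bracket X Y *m g
      = lie_bracket (invmx g *m X *m g) (invmx g *m Y *m g).
    rewrite /lie_bracket mulmxBr mulmxBl !mulmxA.
    by rewrite -!(mulmxA _ g (invmx g)) mulmxV // !mulmx1.
  move: (invmx g *m X *m g) (invmx g *m Y *m g) soX soY uX uY => {}X {}Y soX soY uX uY.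
  apply/mem_std_borel; split; last by apply: upper_mxB; apply: upper_mxM.
  move: soX soY; rewrite /so_mx /lie_bracket => /eqP; rewrite addr_eq0 => /eqP soX.
  move=> /eqP; rewrite addr_eq0 => /eqP soY.
  rewrite [(_ - _)^T]linearB /= !trmx_mul mulmxBl mulmxBr -!mulmxA soX soY !mulmxN.
  rewrite !(mulmxA _^T) soX soY !mulNmx !opprK -!mulmxA.
  by rewrite addrA subrK subrr.
(* After n steps the vanishing band j < i + n covers the whole matrix. *)
- exists n; apply/eqP; rewrite -subv0; apply/subvP => X /(derived_std_borel gu) X0.
  rewrite memv0 (conjE X); have -> : invmx g *m X *m g = 0; last by rewrite mulmx0 mul0mx.
  by apply/matrixP => i j; rewrite X0 ?mxE // ltn_addl.
Qed.

End StandardBorel.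

(** * Conjugacy and normalizers of Borel subalgebras *)

Section BorelConjugacy.
Variables (F : numClosedFieldType) (l : nat).
Notation N := l.*2.+1.
Implicit Types (g h X : 'M[F]_N).

Definition lcols g : 'M[F]_(N, l) := colsub (@lo l) g.

Lemma mulmx_lcols g h : g *m lcols h = lcols (g *m h).
Proof. by apply/matrixP => i j; rewrite !mxE; apply: eq_bigr => k _; rewrite !mxE. Qed.

Definition upper_cols (M : 'M[F]_(N, l)) :=
  forall (i : 'I_N) (k : 'I_l), (k < i)%N -> M i k = 0.

Lemma upper_cols_mul T : upper_mx T -> upper_cols (lcols 1%:M *m T).
Proof.
move=> uT i k ki; rewrite mxE big1 // => m _; rewrite !mxE.
by have [E|_] := eqVneq i (lo m); rewrite ?mul0r // uT ?mulr0 //; rewrite E in ki.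
Qed.

Lemma upper_of_lcols X : upper_cols (lcols X) ->
  (forall i j, X (rev_ord j) (rev_ord i) = 0 -> X i j = 0) -> upper_mx X.
Proof.
move=> uX symX i j ji.
have uXlo (i' : 'I_N) (k : 'I_l) : (k < i')%N -> X i' (lo k) = 0 by move=> /uX; rewrite mxE.
have [jl|lj] := ltnP j l.
  by have -> : j = lo (Ordinal jl) by [apply/val_inj]; apply: uXlo.
apply: symX; case: (idxP i) ji => [k|/=|k] ji.
- by have := ltn_ord k; rewrite /= in ji; lia.
- by move: ji; rewrite val_mid ltnNge lj.
- by rewrite rev_hi; apply: uXlo; move: ji => /=; have := ltn_ord k; have := ltn_ord j; lia.
Qed.

Lemma upper_so X : so_mx X -> upper_cols (lcols X) -> upper_mx X.
Proof.
by move=> /so_mxE soX uX; apply: upper_of_lcols => // i j ji; rewrite soX ji oppr0.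
Qed.

Lemma lcols_unit_full h : h \in unitmx -> row_free (lcols h)^T.
Proof.
move=> hu; apply: inj_row_free => v /(congr1 trmx); rewrite trmx_mul trmxK trmx0 => hv.
apply: trmx_inj; rewrite trmx0.
have : lcols (1%:M : 'M[F]_N) *m v^T = 0.
  by rewrite -(mulVmx hu) -mulmx_lcols -mulmxA hv mulmx0.
move=> /matrixP v0; apply/matrixP => k j; move: (v0 (lo k) j).
rewrite !mxE (bigD1 k) //= !mxE eqxx mul1r big1 ?addr0 // => m mk.
by rewrite !mxE (inj_eq (@lo_inj _)) eq_sym (negPf mk) mul0r.
Qed.

(** An orthogonal map preserving the isotropic steps of the standard flag preserves their
    orthogonals, hence the full flag. Concretely, the right half of the inverse of h mirrors the
    left half of h. *)
Lemma upper_orthogonal h T : orthogonal_mx h -> upper_mx T ->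
  lcols h = lcols 1%:M *m T -> upper_mx h.
Proof.
move=> oh uT hT; have hu := orthogonal_unit oh.
have Tu : T \in unitmx.
  rewrite -unitmx_tr -row_free_unit; apply: inj_row_free => v vT.
  apply: (row_free_inj (lcols_unit_full hu)).
  by rewrite mul0mx hT trmx_mul mulmxA vT mul0mx.
have : upper_cols (lcols (invmx h)).
  have -> : lcols (invmx h) = lcols 1%:M *m invmx T.
    rewrite -[invmx h]mulmx1 -mulmx_lcols -[in LHS](mulmxK Tu (lcols 1%:M)) -hT.
    by rewrite mulmxA mulmx_lcols mulVmx.
  by apply: upper_cols_mul; apply: upper_mxV.
have uh : upper_cols (lcols h) by rewrite hT; apply: upper_cols_mul.
move=> uhV; suff uV : upper_mx (invmx h).
  rewrite -[h]invmxK; apply: upper_orthogonalV => //; exact: orthogonalV.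
have hE i j : invmx h i j = h (rev_ord j) (rev_ord i).
  by rewrite invmx_orthogonal // mulmx_rev mul_revmx mxE.
move=> i j ji.
have [jl|lj] := ltnP j l.
  have := uhV i (Ordinal jl) ji; rewrite mxE.
  by have -> : lo (Ordinal jl) = j by apply/val_inj.
rewrite hE; case: (idxP i) ji => [k|/=|k] ji.
- by have := ltn_ord k; rewrite /= in ji; lia.
- by move: ji; rewrite val_mid ltnNge lj.
- rewrite rev_hi; have := uh (rev_ord j) k; rewrite mxE; apply.
  by move: ji => /=; have := ltn_ord k; have := ltn_ord j; lia.
Qed.

Lemma solvable_sub_std_borel (b : {vspace 'M[F]_N}) :
  solvable_subalgebra (@so_set F N) b ->
  exists g, [/\ orthogonal_mx g, \det g = 1 & (b <= Ad g (std_borel F N))%VS].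
Proof.
move=> [sob subb solb].
have sob' X : X \in b -> X *m revmx = - (revmx *m X^T).
  move=> /sob /eqP; rewrite addr_eq0 => /eqP /(congr1 (mulmx revmx)).
  rewrite mulmxN !mulmxA revmxK mul1mx => /(congr1 (fun Y => Y *m revmx)).
  by rewrite mulNmx -!mulmxA revmxK mulmx1 => ->; rewrite opprK.
have [|A [freeA isoA stA]] := stable_isotropic_flag subb solb sob' (k := l) _.
  by rewrite ltnS.
have {}isoA : A *m revmx *m A^T = 0 by apply/sub_orthP.
(* As X J = - J X^T for J = [revmx], the left factor turns rows stable under right multiplication
   into columns stable under X; the right factor reverses their order, so that X acts on them by an
   upper triangular matrix. *)
pose M : 'M[F]_(N, l) := revmx *m A^T *m revmx.
have [||g [og dg gM]] := @witt_extension F l M.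
- rewrite /M !trmx_mul trmxK !tr_revmx -!mulmxA (mulmxA revmx revmx) revmxK mul1mx.
  by rewrite (mulmxA A) (mulmxA _ A^T) isoA mul0mx mulmx0.
- rewrite /M !trmx_mul trmxK !tr_revmx mulmxA /row_free mxrankMfree.
    by rewrite -mxrank_tr trmx_mul mxrankMfree ?mxrank_tr // tr_revmx row_free_unit revmx_unit.
  by rewrite row_free_unit revmx_unit.
exists g; split=> //; apply/subvP => X Xb; have gu := orthogonal_unit og.
have lgM : lcols g = M.
  by apply/matrixP => i k; move/colP/(_ i): (gM k); rewrite !mxE.
rewrite mem_Ad //; apply/mem_std_borel.
have soX : so_mx (invmx g *m X *m g).
  rewrite -{2}[g]invmxK; apply: so_mx_conj; first exact: orthogonalV.
  exact: sob.
split=> //; apply: upper_so => //.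
have [T uT AX] := stA X Xb.
have XM : X *m M = M *m - (revmx *m T^T *m revmx).
  rewrite /M !mulmxA sob' // !mulNmx -(mulmxA revmx X^T) -trmx_mul AX trmx_mul mulmxN.
  by rewrite !mulmxA -(mulmxA _ revmx revmx) revmxK mulmx1.
clearbody M; have -> : lcols (invmx g *m X *m g) = lcols 1%:M *m - (revmx *m T^T *m revmx).
  by rewrite -mulmx_lcols lgM -(mulmxA _ X) XM mulmxA -lgM mulmx_lcols mulVmx.
apply: upper_cols_mul => i j ji; rewrite mxE mulmx_rev mul_revmx mxE uT ?oppr0 //=.
by have := ltn_ord i; lia.
Qed.

(** Every solvable subalgebra lies in a conjugate of [std_borel], and all these conjugates have the
    same dimension, so they are exactly the maximal ones. *)
Lemma borel_so_conj (b : {vspace 'M[F]_N}) :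
  borel_subalgebra (@so_set F N) b <->
  exists g, [/\ orthogonal_mx g, \det g = 1 & b = Ad g (std_borel F N)].
Proof.
split=> [[solb maxb]|[g [og _ ->]]].
  have [g [og dg bg]] := solvable_sub_std_borel solb; exists g; split=> //.
  by rewrite (maxb _ (Ad_std_borel_solvable og) bg).
split=> [|b' solb' gb']; first exact: Ad_std_borel_solvable.
have [h [oh _ bh]] := solvable_sub_std_borel solb'.
apply/eqP; rewrite eq_sym eqEdim gb' /=.
by rewrite (leq_trans (dimvS bh)) // !dim_Ad ?orthogonal_unit.
Qed.

(** The sign changes in the middle because elements of so are antisymmetric under reflection in the
    antidiagonal, which exchanges the two halves of the superdiagonal. *)
Definition regular_nilpotent : 'M[F]_N :=
  \matrix_(i, j) (if j == i.+1 :> nat then (if (i < l)%N then 1 else -1) else 0).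

Lemma regular_nilpotent_std : regular_nilpotent \in std_borel F N.
Proof.
apply/mem_std_borel; split; last first.
  by move=> i j ji; rewrite mxE; case: eqP => // E; move: ji; rewrite E ltnNge leqnSn.
apply/so_mxE => i j; rewrite !mxE /=.
have := ltn_ord i; have := ltn_ord j; move=> jN iN.
have -> : ((N - i.+1)%N == (N - j.+1).+1) = (j == i.+1 :> nat) by apply/eqP/eqP; lia.
case: eqP => [E|_]; last by rewrite oppr0.
have -> : ((N - j.+1 < l)%N) = ~~ (i < l)%N by apply/idP/idP; lia.
by case: ltnP; rewrite ?opprK.
Qed.

(* The span of the first columns of g is stable under the regular nilpotent,
   whose only invariant subspaces are the coordinate ones. *)
Lemma regular_nilpotent_intertwiner g T : upper_mx T ->
  regular_nilpotent *m g = g *m T -> upper_mx g.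
Proof.
move=> uT ng.
pose e (i : 'I_N) : F := if (i < l)%N then 1 else -1.
have nS (i k : 'I_N) j : k = i.+1 :> nat -> (regular_nilpotent *m g) i j = e i * g k j.
  move=> ki; rewrite mxE (bigD1 k) //= mxE ki eqxx big1 ?addr0 // => m mk.
  by rewrite mxE -ki val_eqE (negPf mk) mul0r.
have n0 (i : 'I_N) j : i.+1 = N -> (regular_nilpotent *m g) i j = 0.
  move=> iN; rewrite mxE big1 // => m _; rewrite mxE iN.
  by case: eqP => [E|]; [have := ltn_ord m; rewrite E ltnn | rewrite mul0r].
move=> i j; have [d] := ubnP j; elim: d i j => // d IH i j jd.
have gT (k : 'I_N) : (j <= k)%N -> (regular_nilpotent *m g) k j = g k j * T j j.
  move=> jk; rewrite ng mxE (bigD1 j) //= big1 ?addr0 // => m mj.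
  have [mj'|jm] := ltnP m j; last by rewrite uT ?mulr0 // ltn_neqAle eq_sym mj.
  by rewrite (IH k m) ?mul0r ?(leq_trans mj') //; move: jd; rewrite ltnS; apply: leq_trans.
have e0 k : e k != 0 by rewrite /e; case: ifP; rewrite ?oppr_eq0 oner_eq0.
(* For k >= j, e_k g_{k+1,j} = g_{k,j} T_{j,j}, the left side being 0 in the last row. If T_{j,j} =
   0, the entries below the diagonal vanish at once; otherwise they vanish from the last row
   upwards. *)
have [T0|T0] := eqVneq (T j j) 0.
  case: i => -[//|i] iN /=; rewrite ltnS => ji.
  have iN' : (i < N)%N by apply: ltnW.
  have := gT (Ordinal iN') ji; rewrite T0 mulr0 (nS _ (Ordinal iN)) // => /eqP.
  by rewrite mulf_eq0 (negPf (e0 _)) => /eqP.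
move=> ji; have [c] := ubnP (N - i)%N; elim: c i ji => // c IHc i ji ic.
have := gT i (ltnW ji); have [iN|Ni] := ltnP i.+1 N.
  have gj : g (Ordinal iN) j = 0 by apply: IHc => /=; lia.
  rewrite (nS _ (Ordinal iN)) // gj mulr0.
  by move/esym/eqP; rewrite mulf_eq0 (negPf T0) orbF => /eqP.
rewrite n0; last by apply/eqP; rewrite eqn_leq ltn_ord Ni.
by move/esym/eqP; rewrite mulf_eq0 (negPf T0) orbF => /eqP.
Qed.

Lemma Ad_upper_std_borel h : orthogonal_mx h -> upper_mx h ->
  Ad h (std_borel F N) = std_borel F N.
Proof.
move=> oh uh; have hu := orthogonal_unit oh.
apply/eqP; rewrite eqEdim dim_Ad // leqnn andbT; apply/subvP => X.
rewrite mem_Ad // => /mem_std_borel[soX uX].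
have -> : X = h *m (invmx h *m X *m h) *m invmx h.
  by rewrite !mulmxA mulmxV // mul1mx mulmxK.
apply/mem_std_borel; split; first exact: so_mx_conj.
by apply: upper_mxM; [apply: upper_mxM|apply: upper_orthogonalV].
Qed.

(** A single element detects the normalizer: the conjugate by h of the regular nilpotent lies in the
    common algebra, so in the frame g it becomes an upper triangular T, which [invmx h *m g]
    intertwines with the nilpotent. *)
Lemma Ad_std_borel_eq g h : orthogonal_mx g -> orthogonal_mx h ->
  Ad g (std_borel F N) = Ad h (std_borel F N) <-> upper_mx (invmx g *m h).
Proof.
move=> og oh; have gu := orthogonal_unit og; have hu := orthogonal_unit oh.
have ok : orthogonal_mx (invmx g *m h) by apply: orthogonalM => //; apply: orthogonalV.
split=> [gh|uk]; last first.
  rewrite -[h in RHS](mulKVmx gu) AdM ?orthogonal_unit //.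
  by rewrite (Ad_upper_std_borel ok uk).
have ku := orthogonal_unit ok; set k := invmx g *m h in ok ku *.
rewrite -[k]invmxK; apply: upper_orthogonalV; first exact: orthogonalV.
have : h *m regular_nilpotent *m invmx h \in Ad g (std_borel F N).
  by rewrite gh mem_Ad // !mulmxA mulVmx // mul1mx mulmxKV // regular_nilpotent_std.
rewrite mem_Ad // => /mem_std_borel[_].
set T := (X in upper_mx X) => uT; apply: (regular_nilpotent_intertwiner uT).
have -> : invmx k = invmx h *m g by rewrite invmx_mul ?unitmx_inv // invmxK.
by rewrite /T !mulmxA mulmxK // mulVmx // mul1mx.
Qed.

End BorelConjugacy.

(** * Normal form of isotropic flags *)

Section BilinearForm.
Variables (F : numClosedFieldType) (n : nat).
Implicit Types (u v w : 'cV[F]_n) (g : 'M[F]_n).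

Definition bform u v : F := (u^T *m revmx *m v) 0 0.

Lemma bformC u v : bform u v = bform v u.
Proof.
rewrite /bform; have -> : u^T *m revmx *m v = (v^T *m revmx *m u)^T; last by rewrite mxE.
by rewrite !trmx_mul trmxK tr_revmx mulmxA.
Qed.

Lemma bformDr u v w : bform u (v + w) = bform u v + bform u w.
Proof. by rewrite /bform mulmxDr mxE. Qed.

Lemma bformZr c u v : bform u (c *: v) = c * bform u v.
Proof. by rewrite /bform -scalemxAr mxE. Qed.

Lemma bformNr u v : bform u (- v) = - bform u v.
Proof. by rewrite -scaleN1r bformZr mulN1r. Qed.

Lemma bformDl u v w : bform (u + v) w = bform u w + bform v w.
Proof. by rewrite ![bform _ w]bformC bformDr. Qed.

Lemma bformZl c u v : bform (c *: u) v = c * bform u v.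
Proof. by rewrite ![bform _ v]bformC bformZr. Qed.

Lemma bformNl u v : bform (- u) v = - bform u v.
Proof. by rewrite ![bform _ v]bformC bformNr. Qed.

Lemma bform_deltal i v : bform (delta_mx i 0) v = v (rev_ord i) 0.
Proof. by rewrite /bform trmx_delta -mulmxA -rowE mxE mul_revmx. Qed.

Lemma bform_deltar i v : bform v (delta_mx i 0) = v (rev_ord i) 0.
Proof. by rewrite bformC bform_deltal. Qed.

Lemma bform_mx m (A : 'M[F]_(n, m)) (x y : 'cV[F]_m) :
  A^T *m revmx *m A = 0 -> bform (A *m x) (A *m y) = 0.
Proof.
by move=> isoA; rewrite /bform trmx_mul -!mulmxA (mulmxA revmx) (mulmxA A^T) (mulmxA A^T) isoA
  mul0mx mulmx0 mxE.
Qed.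

Lemma bform_orthogonal g u v : orthogonal_mx g -> bform (g *m u) (g *m v) = bform u v.
Proof.
move=> og; rewrite /bform trmx_mul -!mulmxA (mulmxA _ g) (mulmxA _ _ v).
by rewrite (mulmxA g^T) og.
Qed.

Lemma orthogonal_deltaP g :
  (forall i j, bform (g *m delta_mx i 0) (g *m delta_mx j 0) = (j == rev_ord i)%:R) ->
  orthogonal_mx g.
Proof. by move=> gE; apply/matrixP => i j; rewrite gramE !colE -/(bform _ _) gE mxE. Qed.

Lemma so_mxP (X : 'M[F]_n) :
  so_mx X <-> forall u v, bform (X *m u) v + bform u (X *m v) = 0.
Proof.
have bE u v : bform (X *m u) v + bform u (X *m v) =
    (u^T *m (X^T *m revmx + revmx *m X) *m v) 0 0.
  by rewrite /bform trmx_mul mulmxDr mulmxDl [RHS]mxE !mulmxA.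
split=> [soX u v|soX]; first by rewrite bE soX mulmx0 mul0mx mxE.
apply/matrixP => i j; have := soX (delta_mx i 0) (delta_mx j 0).
by rewrite bE trmx_delta -rowE -colE !mxE.
Qed.

Lemma orthogonal_mxP g :
  orthogonal_mx g <-> forall u v, bform (g *m u) (g *m v) = bform u v.
Proof.
split=> [og u v|gb]; first exact: bform_orthogonal.
by apply: orthogonal_deltaP => i j; rewrite gb bform_deltal mxE eqxx andbT eq_sym.
Qed.

End BilinearForm.

(** * The subquotient e_1^perp / e_1 *)

Section Embedding.
Variables (F : numClosedFieldType) (l : nat).
Notation N := l.*2.+1.
Notation N2 := l.+1.*2.+1.

Fact emb_subproof (r : 'I_N) : (r.+1 < N2)%N.
Proof. by rewrite doubleS !ltnS ltnW. Qed.

Definition emb (r : 'I_N) : 'I_N2 := Ordinal (emb_subproof r).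
Definition fst_idx : 'I_N2 := lo ord0.
Definition lst_idx : 'I_N2 := hi ord0.

Lemma emb_inj : injective emb.
Proof. by move=> r s /(congr1 val) [] /val_inj. Qed.

Lemma emb_rev r : rev_ord (emb r) = emb (rev_ord r).
Proof. by apply/val_inj => /=; rewrite doubleS; have := ltn_ord r; lia. Qed.

Lemma emb_lo k : emb (lo k) = lo (lift ord0 k).
Proof. exact/val_inj. Qed.

Lemma emb_hi k : emb (hi k) = hi (lift ord0 k).
Proof. by rewrite /hi -emb_rev emb_lo. Qed.

Lemma emb_mid : emb mid = mid.
Proof. by apply/val_inj; rewrite /= !val_mid. Qed.

Lemma emb_neq_fst r : (emb r == fst_idx) = false.
Proof. by rewrite -val_eqE. Qed.

Lemma emb_neq_lst r : (emb r == lst_idx) = false.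
Proof. by rewrite -(inj_eq rev_ord_inj) emb_rev rev_hi emb_neq_fst. Qed.

Lemma rev_fst : rev_ord fst_idx = lst_idx.
Proof. by []. Qed.

Lemma rev_lst : rev_ord lst_idx = fst_idx.
Proof. exact: rev_hi. Qed.

Lemma fst_neq_lst : (fst_idx == lst_idx) = false.
Proof. exact: lo_neq_hi. Qed.

Variant emb_spec : 'I_N2 -> Type :=
  | EmbFst : emb_spec fst_idx
  | EmbMid r : emb_spec (emb r)
  | EmbLst : emb_spec lst_idx.

Lemma embP r : emb_spec r.
Proof.
case: (idxP r) => [k||k]; last 2 first.
- by rewrite -emb_mid; constructor.
- by case: (unliftP ord0 k) => [j|] ->; rewrite -?emb_hi; constructor.
by case: (unliftP ord0 k) => [j|] ->; rewrite -?emb_lo; constructor.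
Qed.

(** Realizes e_1^perp / e_1 as the span of e_0 and the e_k, e_{-k} with k > 1; the transpose is the
    coordinate projection. *)
Definition inj_mx : 'M[F]_(N2, N) := \matrix_(r, s) (r == emb s)%:R.

Lemma tr_inj_mxE m (X : 'M[F]_(N2, m)) r k : (inj_mx^T *m X) r k = X (emb r) k.
Proof.
rewrite mxE (bigD1 (emb r)) //= !mxE eqxx mul1r big1 ?addr0 // => s /negPf sr.
by rewrite !mxE sr mul0r.
Qed.

Lemma inj_mx_emb m (X : 'M[F]_(N, m)) r k : (inj_mx *m X) (emb r) k = X r k.
Proof.
rewrite mxE (bigD1 r) //= !mxE eqxx mul1r big1 ?addr0 // => s /negPf sr.
by rewrite !mxE (inj_eq emb_inj) eq_sym sr mul0r.
Qed.

Lemma inj_mx_fst m (X : 'M[F]_(N, m)) k : (inj_mx *m X) fst_idx k = 0.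
Proof. by rewrite mxE big1 // => s _; rewrite mxE eq_sym emb_neq_fst mul0r. Qed.

Lemma inj_mx_lst m (X : 'M[F]_(N, m)) k : (inj_mx *m X) lst_idx k = 0.
Proof. by rewrite mxE big1 // => s _; rewrite mxE eq_sym emb_neq_lst mul0r. Qed.

Lemma inj_mxK m (X : 'M[F]_(N, m)) : inj_mx^T *m (inj_mx *m X) = X.
Proof. by apply/matrixP => r k; rewrite tr_inj_mxE inj_mx_emb. Qed.

Lemma inj_mx_delta r : inj_mx *m delta_mx r 0 = delta_mx (emb r) 0 :> 'cV_N2.
Proof. by rewrite -colE; apply/colP => s; rewrite !mxE andbT. Qed.

Lemma bform_inj u (v : 'cV[F]_N2) : bform (inj_mx *m u) v = bform u (inj_mx^T *m v).
Proof.
have E : inj_mx^T *m revmx = revmx *m inj_mx^T.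
  apply/matrixP => r s; rewrite tr_inj_mxE mul_revmx !mxE emb_rev.
  by rewrite eq_sym -(inj_eq rev_ord_inj) emb_rev rev_ordK eq_sym.
by rewrite /bform trmx_mul -(mulmxA u^T) E !mulmxA.
Qed.

Lemma bform_split (u v : 'cV[F]_N2) :
  bform u v = u fst_idx 0 * v lst_idx 0 + u lst_idx 0 * v fst_idx 0
              + bform (inj_mx^T *m u) (inj_mx^T *m v).
Proof.
have {1}-> : u = u fst_idx 0 *: delta_mx fst_idx 0 + u lst_idx 0 *: delta_mx lst_idx 0
           + inj_mx *m (inj_mx^T *m u).
  apply/colP => r; case: (embP r) => [|s|]; rewrite [RHS]mxE ?inj_mx_fst ?inj_mx_lst ?inj_mx_emb
    ?tr_inj_mxE !mxE ?eqxx ?emb_neq_fst ?emb_neq_lst ?fst_neq_lst ?(eq_sym lst_idx) ?fst_neq_lst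
    ?mulr1 ?mulr0 ?addr0 ?add0r //.
rewrite !bformDl !bformZl !bform_deltal bform_inj rev_fst rev_lst //.
Qed.

(** Lifts an element of the smaller B' so that e_{-1} goes to f. This forces the scaling of e_1 by
    the inverse of the e_{-1}-coordinate of f, and a correction along e_1 that keeps the images of
    the middle part orthogonal to f; it vanishes on e_0 because f is in e_0^perp. *)
Lemma extend_orthogonal (h' : 'M[F]_N) (f : 'cV[F]_N2) :
  orthogonal_mx h' -> upper_mx h' -> h' *m delta_mx mid 0 = delta_mx mid 0 :> 'cV_N ->
  bform f f = 0 -> f mid 0 = 0 -> f lst_idx 0 != 0 ->
  exists h : 'M[F]_N2,
    [/\ [/\ orthogonal_mx h, upper_mx h & h *m delta_mx mid 0 = delta_mx mid 0 :> 'cV_N2],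
      h *m delta_mx fst_idx 0 = (f lst_idx 0)^-1 *: delta_mx fst_idx 0 :> 'cV_N2,
      h *m delta_mx lst_idx 0 = f &
      forall w : 'cV_N, (h *m (inj_mx *m w)) lst_idx 0 = 0
        /\ inj_mx^T *m (h *m (inj_mx *m w)) = h' *m w].
Proof.
move=> oh' uh' h'mid ff fmid t0; set t := f lst_idx 0 in t0 *.
pose x : 'cV[F]_N2 := delta_mx fst_idx 0; pose y : 'cV[F]_N2 := delta_mx lst_idx 0.
pose h : 'M[F]_N2 := t^-1 *: (x *m x^T) + inj_mx *m h' *m inj_mx^T
  - t^-1 *: (x *m ((inj_mx^T *m f)^T *m revmx *m h' *m inj_mx^T)) + f *m y^T.
have hE v : h *m v = (t^-1 * v fst_idx 0) *: x + inj_mx *m (h' *m (inj_mx^T *m v))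
    - (t^-1 * bform (inj_mx^T *m f) (h' *m (inj_mx^T *m v))) *: x + v lst_idx 0 *: f.
  have dv s : (delta_mx s 0 : 'cV[F]_N2)^T *m v = (v s 0)%:M.
    by rewrite trmx_delta -rowE [row _ _]mx11_scalar mxE.
  rewrite /h !mulmxDl mulNmx -!scalemxAl -!mulmxA !dv !mul_mx_scalar scalerA.
  congr (_ + _ - _ + _); rewrite -scalerA; congr (_ *: _).
  have x11 (z : 'M[F]_1) : x *m z = z 0 0 *: x by rewrite {1}[z]mx11_scalar mul_mx_scalar.
  by rewrite x11 /bform !mulmxA.
have ix : inj_mx^T *m x = 0.
  by apply/colP => s; rewrite tr_inj_mxE !mxE emb_neq_fst.
have iy : inj_mx^T *m y = 0.
  by apply/colP => s; rewrite tr_inj_mxE !mxE emb_neq_lst.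
have xE : (x fst_idx 0 = 1) * (x lst_idx 0 = 0).
  by rewrite !mxE !eqxx [_ == fst_idx]eq_sym fst_neq_lst.
have yE : (y fst_idx 0 = 0) * (y lst_idx 0 = 1).
  by rewrite !mxE !eqxx fst_neq_lst.
have hx : h *m x = t^-1 *: x.
  by rewrite hE ix !xE !mulmx0 /bform mulmx0 mxE mulr0 mulr1 !scale0r subr0 !addr0.
have hy : h *m y = f.
  by rewrite hE iy !yE !mulmx0 /bform mulmx0 mxE mulr0 !scale0r subr0 !add0r scale1r.
have hi w : h *m (inj_mx *m w) = inj_mx *m (h' *m w)
    - (t^-1 * bform (inj_mx^T *m f) (h' *m w)) *: x.
  by rewrite hE inj_mxK inj_mx_fst inj_mx_lst mulr0 !scale0r addr0 add0r.
have hilst (w : 'cV_N) : (h *m (inj_mx *m w)) lst_idx 0 = 0.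
  by rewrite hi mxE inj_mx_lst 2!mxE xE mulr0 oppr0 addr0.
have himid (w : 'cV_N) : inj_mx^T *m (h *m (inj_mx *m w)) = h' *m w.
  by rewrite hi mulmxBr -scalemxAr ix scaler0 subr0 inj_mxK.
have hif w : bform (h *m (inj_mx *m w)) f = 0.
  rewrite hi bformDl bformNl bformZl bform_deltal rev_fst -/t bform_inj mulrAC mulVf // mul1r.
  by rewrite bformC subrr.
have oh : orthogonal_mx h.
  apply: orthogonal_deltaP => i j.
  case: (embP i) => [|r|]; case: (embP j) => [|s|];
    rewrite -?inj_mx_delta -/x -/y ?hx ?hy ?bformZl ?bformZr
    ?bform_deltal ?bform_deltar ?rev_fst ?rev_lst ?hilst ?xE ?yE -/t ?mulVf ?ff
    ?(bformC f) ?hif ?bform_split ?hilst ?himid ?mul0r ?mulr0 ?add0r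
    ?bform_orthogonal ?bform_deltal ?emb_rev ?eqxx ?fst_neq_lst
    ?(eq_sym lst_idx) ?fst_neq_lst ?emb_neq_fst ?emb_neq_lst //.
  by rewrite mxE eqxx andbT (inj_eq emb_inj) eq_sym.
exists h; split=> //; split=> //.
  move=> i j; have -> : h i j = (h *m delta_mx j 0 : 'cV_N2) i 0 by rewrite -colE [RHS]mxE.
  case: (embP j) => [|s|]; last by move=> /= ji; exfalso; have := ltn_ord i; lia.
    case: (embP i) => [|r|]; rewrite -/x ?hx ?ltnn // mxE mxE ?emb_neq_fst ?mulr0 //.
  rewrite -inj_mx_delta; case: (embP i) => [|r|] //; rewrite ?hilst //=.
  rewrite -[LHS]tr_inj_mxE himid -colE mxE ltnS; exact: uh'.
rewrite -emb_mid -inj_mx_delta hi h'mid bform_deltar rev_mid tr_inj_mxE emb_mid.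
by rewrite fmid mulr0 scale0r subr0.
Qed.

End Embedding.

Section NormalForm.
Variables (F : numClosedFieldType) (l : nat).
Notation N := l.*2.+1.
Implicit Types (E S : 'I_l -> bool) (tau : 'S_l).

Definition is_last E (k : 'I_l) := [forall j, E j ==> (j <= k)%N].

(* The signed partial permutation is encoded by indices: tau k is the position
   of the index k, S is the set of negative indices and E the set of indices
   that are not used. The free positions are filled with E in increasing order,
   so that column i, for tau^-1 i in E, is
     e_0 - 1/2 e_m + sum of e_{-k} over k in E with tau k >= i,  m = max E. *)
Definition nf_mx E S tau : 'M[F]_(N, l) := \matrix_(r, i)
  frame (fun k => if E ((tau^-1)%g i) then - 2^-1 * (E k && is_last E k)%:R
                  else (~~ S k && (tau k == i))%:R)
        (fun k => if E ((tau^-1)%g i) then (E k && (i <= tau k)%N)%:R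
                  else (S k && (tau k == i))%:R)
        (E ((tau^-1)%g i))%:R r.

Definition valid_code E S tau :=
  (forall k, E k -> S k) /\
  (forall k k', E k -> E k' -> (k < k')%N -> (tau k < tau k')%N).

Definition has_nf (A : 'M[F]_(N, l)) := exists (h : 'M[F]_N) E S tau (T : 'M[F]_l),
  [/\ [/\ orthogonal_mx h, upper_mx h & h *m delta_mx mid 0 = delta_mx mid 0 :> 'cV_N],
      valid_code E S tau, upper_mx T & A = h *m nf_mx E S tau *m T].

End NormalForm.

(** * Inserting the index 1 into a code *)

Section ExtendCode.
Variables (F : numClosedFieldType) (l : nat).
Notation N := l.*2.+1.
Notation N2 := l.+1.*2.+1.
Variables (E S : 'I_l -> bool) (tau : 'S_l) (p : 'I_l.+1) (e s : bool).

Definition ext (b : bool) (P : 'I_l -> bool) (k : 'I_l.+1) := oapp P b (unlift ord0 k).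

Lemma ext0 b P : ext b P ord0 = b.
Proof. by rewrite /ext unlift_none. Qed.

Lemma ext_lift b P k : ext b P (lift ord0 k) = P k.
Proof. by rewrite /ext liftK. Qed.

Let tau' : 'S_l.+1 := lift_perm ord0 p tau.
Let nf' := nf_mx F (ext e E) (ext s S) tau'.

Lemma lift_permV0 : ((tau'^-1)%g p = ord0) *
  (forall i, (tau'^-1)%g (lift p i) = lift ord0 ((tau^-1)%g i)).
Proof. by rewrite lift_permV; split=> [|i]; rewrite ?lift_perm_id ?lift_perm_lift. Qed.

Lemma leq_lift (i j : 'I_l) : (lift p i <= lift p j)%N = (i <= j)%N.
Proof. by rewrite /= leq_bump2. Qed.

Lemma leq_lift_self (i : 'I_l) : (p <= lift p i)%N = (p <= i)%N.
Proof. by rewrite /= leq_bump /unbump ltnn subn0. Qed.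

Lemma is_last_ext b k : is_last (ext b E) (lift ord0 k) = is_last E k.
Proof.
apply/forallP/forallP => H j.
  by have := H (lift ord0 j); rewrite ext_lift /= /bump.
case: (unliftP ord0 j) => [j'|] ->; first by rewrite ext_lift; have := H j'.
by rewrite implybT.
Qed.

Lemma is_last_ext0 b : is_last (ext b E) ord0 = ~~ [exists j, E j].
Proof.
apply/forallP/idP => [H|H j].
  by apply/existsP => -[j Ej]; have := H (lift ord0 j); rewrite ext_lift Ej.
case: (unliftP ord0 j) => [j'|] ->; last by rewrite implybT.
rewrite ext_lift; apply/implyP => Ej; case/negP: H; apply/existsP; by exists j'.
Qed.

Lemma frame_fst T (a b : 'I_l.+1 -> T) c : frame a b c (fst_idx l) = a ord0.
Proof. exact: frame_lo. Qed.

Lemma frame_lst T (a b : 'I_l.+1 -> T) c : frame a b c (lst_idx l) = b ord0.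
Proof. exact: frame_hi. Qed.

Lemma fst_neq_mid : (fst_idx l == mid) = false.
Proof. exact: lo_neq_mid. Qed.

Lemma lst_neq_mid : (lst_idx l == mid) = false.
Proof. exact: hi_neq_mid. Qed.

(** The hypothesis places a free index 1 before all other free positions, so that e_{-1} occurs in
    no column but p. *)
Lemma nf_ext_lift (i : 'I_l) :
  (e -> forall i, E ((tau^-1)%g i) -> (p <= i)%N) ->
  col (lift p i) nf' = inj_mx F l *m col i (nf_mx F E S tau).
Proof.
move=> ep; apply/colP => r; rewrite mxE [nf' _ _]mxE lift_permV0 ext_lift.
have ni : (p == lift p i) = false by apply/negbTE; rewrite neq_lift.
case: (embP r) => [|{}r|]; rewrite ?inj_mx_fst ?inj_mx_lst ?inj_mx_emb.
- rewrite frame_fst ext0 is_last_ext0 lift_perm_id ni andbF.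
  case: ifP => // Ei; have -> : [exists j, E j] by apply/existsP; exists ((tau^-1)%g i).
  by rewrite andbF mulr0.
- rewrite !mxE; case: (idxP r) => [k||k].
  + rewrite emb_lo !frame_lo !ext_lift is_last_ext lift_perm_lift.
    by rewrite (inj_eq (@lift_inj _ p)).
  + by rewrite emb_mid !frame_mid.
  + rewrite emb_hi !frame_hi !ext_lift lift_perm_lift leq_lift.
    by rewrite (inj_eq (@lift_inj _ p)).
- rewrite frame_lst !ext0 lift_perm_id ni andbF.
  case: ifP => // Ei; case: (e) ep => // /(_ isT _ Ei) pi.
  by rewrite leqNgt ltn_neqAle leq_lift_self pi val_eqE ni.
Qed.

Lemma nf_ext_new : e = false ->
  col p nf' = delta_mx (if s then lst_idx l else fst_idx l) 0.
Proof.
move=> e0; apply/colP => r; rewrite mxE [nf' _ _]mxE lift_permV0 ext0 e0 /= mxE andbT.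
have nk k : (lift p k == p) = false by apply/negbTE; rewrite eq_sym neq_lift.
case: (embP r) => [|{}r|].
- rewrite frame_fst ext0 lift_perm_id eqxx andbT; case: (s); rewrite ?eqxx ?fst_neq_lst //.
- have -> : (emb r == (if s then lst_idx l else fst_idx l)) = false.
    by case: (s); rewrite ?emb_neq_fst ?emb_neq_lst.
  case: (idxP r) => [k||k].
  + by rewrite emb_lo frame_lo lift_perm_lift nk andbF.
  + by rewrite emb_mid frame_mid.
  + by rewrite emb_hi frame_hi lift_perm_lift nk andbF.
- rewrite frame_lst ext0 lift_perm_id eqxx andbT.
  by case: (s); rewrite ?eqxx // eq_sym fst_neq_lst.
Qed.

Lemma nf_ext_free_empty : e -> (forall k, E k = false) ->
  col p nf' = delta_mx mid 0 - 2^-1 *: delta_mx (fst_idx l) 0 + delta_mx (lst_idx l) 0.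
Proof.
move=> e1 E0; apply/colP => r; rewrite mxE [nf' _ _]mxE lift_permV0 ext0 e1 !mxE !andbT.
have E0' : [exists j, E j] = false by apply/existsP => -[j]; rewrite E0.
case: (embP r) => [|{}r|].
- by rewrite frame_fst ext0 is_last_ext0 E0' fst_neq_mid eqxx fst_neq_lst addr0 add0r /= !mulr1.
- rewrite emb_neq_fst emb_neq_lst mulr0 subr0 addr0.
  case: (idxP r) => [k||k].
  + by rewrite emb_lo frame_lo ext_lift E0 lo_neq_mid mulr0.
  + by rewrite emb_mid frame_mid eqxx.
  + by rewrite emb_hi frame_hi ext_lift E0 hi_neq_mid.
- rewrite frame_lst ext0 lift_perm_id leqnn lst_neq_mid eqxx eq_sym fst_neq_lst.
  by rewrite mulr0 subr0 add0r.
Qed.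

(** The sums in free columns are nested: the new first free column is the former first one plus
    e_{-1}. *)
Lemma nf_ext_free (i : 'I_l) : e ->
  E ((tau^-1)%g i) -> (forall j, E ((tau^-1)%g j) -> (i <= j)%N) -> (p <= i)%N ->
  col p nf' = inj_mx F l *m col i (nf_mx F E S tau) + delta_mx (lst_idx l) 0.
Proof.
move=> e1 Ei imin pi; apply/colP => r; rewrite mxE [nf' _ _]mxE lift_permV0 ext0 e1 [RHS]mxE.
rewrite [delta_mx _ _ _ _]mxE andbT.
have Emin k : E k -> (i <= tau k)%N by move=> Ek; apply: imin; rewrite permK.
case: (embP r) => [|{}r|]; rewrite ?inj_mx_fst ?inj_mx_lst ?inj_mx_emb.
- rewrite frame_fst ext0 is_last_ext0 fst_neq_lst addr0.
  have -> : [exists j, E j] by apply/existsP; exists ((tau^-1)%g i).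
  by rewrite andbF mulr0.
- rewrite !mxE emb_neq_lst addr0 Ei; case: (idxP r) => [k||k].
  + by rewrite emb_lo !frame_lo ext_lift is_last_ext.
  + by rewrite emb_mid !frame_mid.
  + rewrite emb_hi !frame_hi ext_lift lift_perm_lift leq_lift_self.
    by case Ek : (E k) => //=; rewrite Emin // (leq_trans pi) // Emin.
- by rewrite frame_lst ext0 lift_perm_id leqnn eqxx add0r.
Qed.

Lemma valid_code_ext : valid_code E S tau -> (e -> s) ->
  (e -> forall i, E ((tau^-1)%g i) -> (p <= i)%N) ->
  valid_code (ext e E) (ext s S) tau'.
Proof.
move=> [ES incr] es ep; split=> [k|k k'].
  by case: (unliftP ord0 k) => [j|] ->; rewrite ?ext0 ?ext_lift //; apply: ES.
case: (unliftP ord0 k) => [j|] ->; case: (unliftP ord0 k') => [j'|] ->;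
  rewrite ?ext0 ?ext_lift ?lift_perm_id ?lift_perm_lift //.
  by move=> Ej Ej' jj'; rewrite !ltnNge leq_lift -ltnNge; apply: incr.
move=> e1 Ej' _; rewrite ltn_neqAle leq_lift_self ep ?permK // andbT.
by rewrite val_eqE neq_lift.
Qed.

End ExtendCode.

(** * Lifting a normal form from e_1^perp / e_1 *)

Section Assemble.
Variables (F : numClosedFieldType) (l : nat).
Notation N := l.*2.+1.
Notation N2 := l.+1.*2.+1.

Lemma col_mulmx m n q (A : 'M[F]_(m, n)) (B : 'M[F]_(n, q)) k :
  col k (A *m B) = A *m col k B.
Proof. by rewrite !colE mulmxA. Qed.

Lemma mulmx_col_sum m n q (A : 'M[F]_(m, n)) (B : 'M[F]_(n, q)) k :
  col k (A *m B) = \sum_i B i k *: col i A.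
Proof.
apply/colP => r; rewrite !mxE summxE; apply: eq_bigr => i _.
by rewrite !mxE mulrC.
Qed.

Variables (A : 'M[F]_(N2, l.+1)) (p : 'I_l.+1).
Variables (h' : 'M[F]_N) (E S : 'I_l -> bool) (tau : 'S_l) (T : 'M[F]_l).
Variables (f : 'cV[F]_N2) (e s : bool).
Local Notation nf' := (nf_mx F (ext e E) (ext s S) (lift_perm ord0 p tau)).

(** The common part of the three cases of the induction step, which differ in the image f of e_{-1}
    and in how column p arises. As h is built inside, column p is an obligation on any h with the
    listed properties. *)
Lemma has_nf_assemble :
  [/\ orthogonal_mx h', upper_mx h' & h' *m delta_mx mid 0 = delta_mx mid 0 :> 'cV_N] ->
  valid_code E S tau -> (e -> s) -> upper_mx T ->
  (e -> forall i, E ((tau^-1)%g i) -> (p <= i)%N) ->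
  (forall k, A (lst_idx l) (lift p k) = 0) ->
  (inj_mx F l)^T *m colsub (lift p) A = h' *m nf_mx F E S tau *m T ->
  [/\ bform f f = 0, f mid 0 = 0, f (lst_idx l) 0 != 0 &
    forall k, bform (col (lift p k) A) f = 0] ->
  (forall h : 'M[F]_N2,
     h *m delta_mx (fst_idx l) 0 = (f (lst_idx l) 0)^-1 *: delta_mx (fst_idx l) 0 :> 'cV_N2 ->
     h *m delta_mx (lst_idx l) 0 = f ->
     h *m delta_mx mid 0 = delta_mx mid 0 :> 'cV_N2 ->
     (forall (v : 'cV_N2) w, v (lst_idx l) 0 = 0 -> (inj_mx F l)^T *m v = h' *m w ->
        bform v f = 0 -> v = h *m (inj_mx F l *m w)) ->
     exists c, col p A = c *: (h *m col p nf')) ->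
  has_nf A.
Proof.
move=> [oh' uh' h'mid] vc es uT ep Alst Amid [ff fmid f0 Af] colp.
have [h [[oh uh hmid] hx hy hi]] := extend_orthogonal oh' uh' h'mid ff fmid f0.
(* Two vectors of e_1^perp with the same class modulo e_1 differ by a multiple of e_1, which is
   detected by pairing with f. *)
have huniq (v : 'cV_N2) w : v (lst_idx l) 0 = 0 -> (inj_mx F l)^T *m v = h' *m w ->
    bform v f = 0 -> v = h *m (inj_mx F l *m w).
  move=> vl vm vf; have [wl wm] := hi w.
  have wf : bform (h *m (inj_mx F l *m w)) f = 0.
    by rewrite -hy bform_orthogonal // bform_deltar rev_lst inj_mx_fst.
  set u := h *m _ in wl wm wf *.
  have : bform (v - u) f = 0 by rewrite bformDl bformNl vf wf subrr.
  rewrite bform_split mulmxBr vm wm subrr -[0 : 'cV_N](mulmx0 _ (inj_mx F l)^T).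
  rewrite mulmx0 /bform trmx0 !mul0mx [(0 : 'M_1) 0 0]mxE addr0.
  rewrite [X in _ + X * _]mxE [X in _ + (_ + X) * _]mxE vl wl subrr mul0r addr0.
  move=> /eqP; rewrite mulf_eq0 (negPf f0) orbF mxE [X in _ + X]mxE subr_eq0 => /eqP vf'.
  apply/colP => r; case: (embP r) => [|{}r|] //; last by rewrite vl wl.
  by rewrite -!tr_inj_mxE vm wm.
have [c colpE] := colp h hx hy hmid huniq.
exists h, (ext e E), (ext s S), (lift_perm ord0 p tau).
(* T with a row and a column inserted at p, zero except for c on the diagonal. *)
exists (\matrix_(i, k) match unlift p i, unlift p k with
  | Some i', Some k' => T i' k' | None, None => c | _, _ => 0 end).
split=> //; first exact: valid_code_ext.
  move=> i k; rewrite mxE; case: (unliftP p i) => [i'|] ->; case: (unliftP p k) => [k'|] -> //.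
    by rewrite ltnNge leq_lift -ltnNge; apply: uT.
  by rewrite ltnn.
apply/trmx_inj/row_matrixP => k; rewrite -!tr_col; congr (_^T).
rewrite mulmx_col_sum (bigD1_ord p) //= mxE unlift_none.
case: (unliftP p k) => [k'|] ->.
  rewrite scale0r add0r.
  transitivity (h *m (inj_mx F l *m (nf_mx F E S tau *m col k' T))).
    apply: huniq; [by rewrite mxE Alst | | exact: Af].
    have := congr1 (col k') Amid; rewrite !col_mulmx -mulmxA => <-.
    by congr (_ *m _); apply/colP => r; rewrite !mxE.
  rewrite -col_mulmx mulmx_col_sum !mulmx_sumr; apply: eq_bigr => i _.
  rewrite mxE !liftK -!scalemxAr; congr (_ *: _).
  by rewrite col_mulmx nf_ext_lift.
rewrite big1 ?addr0 => [|i _]; first by rewrite colpE col_mulmx.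
by rewrite mxE liftK unlift_none scale0r.
Qed.

End Assemble.

(** * The induction step *)

Section NormalFormStep.
Variables (F : numClosedFieldType) (l : nat).
Notation N := l.*2.+1.
Notation N2 := l.+1.*2.+1.

Lemma gram_col n m q (X : 'M[F]_(n, m)) (Y : 'M[F]_(n, q)) i j :
  (X^T *m revmx *m Y) i j = bform (col i X) (col j Y).
Proof. by rewrite /bform tr_col -row_mul (colE j) mulmxA -row_mul -colE !mxE. Qed.

Lemma row_free_tr_inj m n q (A : 'M[F]_(m, n)) (x : 'M[F]_(n, q)) :
  row_free A^T -> A *m x = 0 -> x = 0.
Proof.
move=> freeA /(congr1 trmx); rewrite trmx_mul trmx0 => /eqP.
by rewrite mulmx_free_eq0 // trmx_eq0 => /eqP.
Qed.

Lemma mulmx_mid_fixed n (h : 'M[F]_n.*2.+1) (v : 'cV[F]_n.*2.+1) :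
  orthogonal_mx h -> h *m delta_mx mid 0 = delta_mx mid 0 :> 'cV_(n.*2.+1) ->
  (h *m v) mid 0 = v mid 0.
Proof.
move=> oh hmid; rewrite -{1}rev_mid -[LHS]bform_deltal -hmid bform_orthogonal //.
by rewrite bform_deltal rev_mid.
Qed.

Lemma bform_self_lo n (y : 'cV[F]_n.*2.+1) :
  (forall k, y (hi k) 0 = 0) -> y mid 0 = 0 -> bform y y = 0.
Proof.
move=> yhi ymid; rewrite /bform -mulmxA mxE big1 // => i _; rewrite mul_revmx mxE.
by case: (idxP i) => [k||k]; rewrite ?rev_mid ?ymid ?yhi ?mulr0 ?mul0r.
Qed.

(** Provides the image of e_{-1} when column p is e_1. A dual vector from Witt's theorem is moved
    into e_0^perp along some z orthogonal to all columns, and made isotropic along column p, which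
    has no e_0-coordinate. *)
Lemma dual_vector n (A : 'M[F]_(n.*2.+1, n)) (p : 'I_n) :
  A^T *m revmx *m A = 0 -> row_free A^T -> A mid p = 0 ->
  exists f : 'cV[F]_n.*2.+1, [/\ bform f f = 0, f mid 0 = 0 &
    forall k, bform (col k A) f = (k == p)%:R].
Proof.
move=> isoA freeA Ap; have [g [og _ gA]] := witt_extension isoA freeA.
have gd k : col k A = g *m delta_mx (lo k) 0 by rewrite -gA colE.
have iso k k' : bform (col k A) (col k' A) = 0 by rewrite -gram_col isoA mxE.
(* The orthogonal of the columns of A is not contained in the orthogonal of the
   anisotropic vector e_0. *)
have [z z0 zA] : exists2 z : 'cV[F]_n.*2.+1, z mid 0 != 0 & forall k, bform (col k A) z = 0.
  apply: contrapT => noz; have zero z : (forall k, bform (col k A) z = 0) -> z mid 0 = 0.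
    by move=> zA; apply: contrapT => /eqP z0; apply: noz; exists z.
  pose y := invmx g *m (delta_mx mid 0 : 'cV[F]_n.*2.+1).
  have gy : g *m y = delta_mx mid 0 by rewrite mulKVmx // orthogonal_unit.
  have : bform y y = 0.
    apply: bform_self_lo => [k|].
      rewrite -[LHS]bform_deltal -(bform_orthogonal _ _ og) gy -gd.
      by rewrite bform_deltar rev_mid; apply: zero => k'.
    rewrite -{1}rev_mid -[LHS]bform_deltal -(bform_orthogonal _ _ og) gy.
    rewrite bform_deltar rev_mid; apply: zero => k.
    by rewrite gd bform_orthogonal // bform_deltal mxE hi_neq_mid.
  rewrite -(bform_orthogonal _ _ og) gy bform_deltal rev_mid mxE !eqxx.
  by move/eqP; rewrite oner_eq0.
pose f0 := g *m (delta_mx (hi p) 0 : 'cV[F]_n.*2.+1).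
have f0A k : bform (col k A) f0 = (k == p)%:R.
  by rewrite gd bform_orthogonal // bform_deltal mxE (inj_eq (@hi_inj _)) eqxx andbT.
pose f1 := f0 - (f0 mid 0 / z mid 0) *: z.
have f1A k : bform (col k A) f1 = (k == p)%:R.
  by rewrite bformDr bformNr bformZr zA mulr0 subr0.
have f1m : f1 mid 0 = 0 by rewrite mxE [X in _ + X]mxE [X in _ - X]mxE divfK // subrr.
move: f1 f1A f1m => {f0 f0A z z0 zA} f1 f1A f1m.
exists (f1 - (2^-1 * bform f1 f1) *: col p A); split.
- rewrite bformDr bformNr bformZr !bformDl !bformNl !bformZl iso mulr0 subr0.
  rewrite (bformC f1 (col _ _)) f1A eqxx mulr1 -addrA -opprD -mulrDl.
  by rewrite -mulr2n -[_^-1 *+ _]mulr_natr mulVf ?pnatr_eq0 // mul1r subrr.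
- by rewrite mxE [X in _ + X]mxE [X in _ - X]mxE f1m [col _ _ _ _]mxE Ap mulr0 subrr.
- by move=> k; rewrite bformDr bformNr bformZr iso f1A mulr0 subr0.
Qed.

Variables (A : 'M[F]_(N2, l.+1)) (p : 'I_l.+1).
Hypothesis isoA : A^T *m revmx *m A = 0.
Hypothesis freeA : row_free A^T.
Hypothesis Alst : forall k, A (lst_idx l) (lift p k) = 0.
Hypothesis Ap : [\/ col p A = delta_mx (fst_idx l) 0,
  A (lst_idx l) p != 0 /\ A mid p = 0 |
  [/\ A (lst_idx l) p != 0, A mid p = 1 & forall k : 'I_l.+1, (k < p)%N -> A mid k = 0]].

Lemma colsub_lift_mul (w : 'cV[F]_l) :
  colsub (lift p) A *m w = A *m \col_i oapp (fun j => w j 0) 0 (unlift p i).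
Proof.
apply/colP => r; rewrite !mxE (bigD1_ord p) //= !mxE unlift_none mulr0 add0r.
by apply: eq_bigr => i _; rewrite !mxE liftK.
Qed.

Local Notation A' := ((inj_mx F l)^T *m colsub (lift p) A).

Lemma step_isotropic : A'^T *m revmx *m A' = 0.
Proof.
apply/matrixP => i j; rewrite gram_col [RHS]mxE !col_mulmx.
have : bform (col i (colsub (lift p) A)) (col j (colsub (lift p) A)) = 0.
  have cs k : col k (colsub (lift p) A) = col (lift p k) A by apply/colP => r; rewrite !mxE.
  by rewrite !cs -gram_col isoA mxE.
by rewrite bform_split !mxE !Alst mulr0 mul0r !add0r.
Qed.

(** A relation between projected columns puts a multiple of e_1 in the span of the columns other
    than p. Either column p is e_1 and independence applies, or column p is orthogonal to this span
    but not to e_1, so the multiple is 0. *)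
Lemma step_free : row_free A'^T.
Proof.
apply: inj_row_free => v /(congr1 trmx); rewrite trmx_mul trmxK trmx0 -mulmxA => Av.
set u := colsub (lift p) A *m v^T in Av.
have ulst : u (lst_idx l) 0 = 0 by rewrite mxE big1 // => i _; rewrite !mxE Alst mul0r.
have uE : u = u (fst_idx l) 0 *: delta_mx (fst_idx l) 0.
  apply/colP => r; case: (embP r) => [|{}r|].
  - by rewrite [RHS]mxE [X in _ * X]mxE !eqxx mulr1.
  - by rewrite -tr_inj_mxE Av [RHS]mxE [X in _ * X]mxE emb_neq_fst mulr0 mxE.
  - by rewrite ulst [RHS]mxE [X in _ * X]mxE [_ == fst_idx l]eq_sym fst_neq_lst mulr0.
pose w : 'cV[F]_l.+1 := \col_i oapp (fun j => v^T j 0) 0 (unlift p i).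
have uA : u = A *m w by apply: colsub_lift_mul.
suff [c Ac] : exists c, A *m (w - c *: delta_mx p 0) = 0.
  have /matrixP wc := row_free_tr_inj freeA Ac.
  apply/rowP => i; have := wc (lift p i) 0; rewrite !mxE liftK /=.
  by rewrite [_ == p]eq_sym (negPf (neq_lift _ _)) mulr0 subr0 mxE.
case: Ap => [Ap1|[Ap1 _]|[Ap1 _ _]].
- by exists (u (fst_idx l) 0); rewrite mulmxBr -uA -scalemxAr -colE Ap1 -uE subrr.
- exists 0; rewrite scale0r subr0 -uA.
  have : bform (col p A) u = 0 by rewrite uA colE bform_mx.
  rewrite uE bformZr bform_deltar rev_fst [col _ _ _ _]mxE => /eqP.
  by rewrite mulf_eq0 (negPf Ap1) orbF => /eqP->; rewrite scale0r.
- exists 0; rewrite scale0r subr0 -uA.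
  have : bform (col p A) u = 0 by rewrite uA colE bform_mx.
  rewrite uE bformZr bform_deltar rev_fst [col _ _ _ _]mxE => /eqP.
  by rewrite mulf_eq0 (negPf Ap1) orbF => /eqP->; rewrite scale0r.
Qed.

Lemma has_nf_step : has_nf A' -> has_nf A.
Proof.
move=> [h' [E [S [tau [T [[oh' uh' h'mid] vc uT A'E]]]]]].
have Tu : T \in unitmx.
  rewrite -unitmx_tr -row_free_unit; apply: inj_row_free => v vT.
  apply: (row_free_inj step_free).
  by rewrite mul0mx A'E trmx_mul mulmxA vT mul0mx.
have isoc k k' : bform (col k A) (col k' A) = 0 by rewrite -gram_col isoA mxE.
have bfst (v : 'cV[F]_N2) : bform (delta_mx (fst_idx l) 0) v = v (lst_idx l) 0.
  by rewrite bform_deltal.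
case: Ap => [Ap1|[Ap1 Ap2]|[Ap1 Ap2 Ap3]].
(* Column p is e_1; f has e_{-1}-coordinate 1, so h fixes e_1. *)
- have Apm : A mid p = 0 by move/colP/(_ mid): Ap1; rewrite !mxE eq_sym fst_neq_mid.
  have [f [ff fmid fA]] := dual_vector isoA freeA Apm.
  have flst : f (lst_idx l) 0 = 1 by rewrite -bfst -Ap1 fA eqxx.
  apply: (@has_nf_assemble F l A p h' E S tau T f false false) => //.
    split=> //; first by rewrite flst oner_eq0.
    by move=> k; rewrite fA eq_sym (negPf (neq_lift _ _)).
  move=> h hx _ _ _; exists 1; rewrite scale1r nf_ext_new // hx flst invr1 scale1r.
  exact: Ap1.
(* Column p lies in e_0^perp and is itself the image of e_{-1}. *)
- apply: (@has_nf_assemble F l A p h' E S tau T (col p A) false true) => //.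
    by split=> //; rewrite mxE.
  move=> h _ hy _ _; exists 1; rewrite scale1r nf_ext_new // hy.
have midA k : A mid (lift p k) = \sum_i (E ((tau^-1)%g i))%:R * T i k.
  have := congr1 (fun M : 'M_(N, l) => M mid k) A'E.
  rewrite /= tr_inj_mxE emb_mid mxE => ->.
  rewrite -mulmxA.
  have -> : (h' *m (nf_mx F E S tau *m T)) mid k = (h' *m col k (nf_mx F E S tau *m T)) mid 0.
    by rewrite -col_mulmx [RHS]mxE.
  rewrite mulmx_mid_fixed // !mxE; apply: eq_bigr => i _.
  by rewrite mxE frame_mid.
(* As h' preserves e_0-coordinates and T is triangular and invertible, a free position before p
   would give an earlier column a nonzero e_0-coordinate. *)
have ep i : E ((tau^-1)%g i) -> (p <= i)%N.
  have [d] := ubnP i; elim: d i => // d IH i id Ei; rewrite leqNgt; apply/negP => ip.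
  have : A mid (lift p i) = 0.
    by apply: Ap3; rewrite /= /bump [(p <= i)%N]leqNgt ip.
  rewrite midA (bigD1 i) //= big1 => [|k ki]; last first.
    have [lt_ki|le_ik] := ltnP k i; last by rewrite uT ?mulr0 // ltn_neqAle eq_sym ki.
    case Ek: (E _); last by rewrite mul0r.
    have pk : (p <= k)%N by apply: IH; rewrite // (leq_trans lt_ki) // -ltnS.
    by have := leq_ltn_trans pk (ltn_trans lt_ki ip); rewrite ltnn.
  by rewrite Ei mul1r addr0 => /eqP; rewrite (negPf (upper_unit_diag i uT Tu)).
set t := A (lst_idx l) p in Ap1.
have [i0 Ei0|E0] := pickP (fun i => E ((tau^-1)%g i)); last first.
  have {}E0 k : E k = false by rewrite -[k](permK tau) E0.
  (* Solved from h (e_0 - 1/2 e_1 + e_{-1}) = column p, where h e_1 = t^-1 e_1 and h e_{-1} = f. *)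
  pose f := col p A - delta_mx mid 0 + (2^-1 * t^-1) *: delta_mx (fst_idx l) 0.
  have fE r : f r 0 = A r p - (r == mid)%:R + 2^-1 * t^-1 * (r == fst_idx l)%:R.
    by rewrite !mxE !andbT.
  have flst : f (lst_idx l) 0 = t.
    by rewrite fE lst_neq_mid [_ == fst_idx l]eq_sym fst_neq_lst mulr0 subr0 addr0.
  apply: (@has_nf_assemble F l A p h' E S tau T f true true) => //.
    split; last first.
    - move=> k; rewrite /f !bformDr bformNr bformZr isoc bform_deltar rev_mid.
      rewrite bformC bfst [col _ _ _ _]mxE [col _ _ _ _]mxE Alst mulr0 addr0 midA.
      by rewrite big1 ?subrr // => i _; rewrite E0 mul0r.
    - by rewrite flst.
    - by rewrite fE Ap2 [_ == fst_idx l]eq_sym fst_neq_mid mulr0 eqxx subrr addr0.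
    have aa : bform (col p A) (col p A) = 0 by apply: isoc.
    have mm : bform (delta_mx mid 0 : 'cV[F]_N2) (delta_mx mid 0) = 1.
      by rewrite bform_deltal rev_mid mxE !eqxx.
    have am : bform (col p A) (delta_mx mid 0) = 1 by rewrite bform_deltar rev_mid mxE.
    rewrite {1}/f bformDl bformZl bfst flst bformDl bformNl /f !bformDr !bformNr !bformZr.
    rewrite aa am (bformC (delta_mx mid 0) (col p A)) am mm !bform_deltar rev_fst.
    rewrite [col _ _ _ _]mxE -/t [delta_mx _ _ _ _]mxE lst_neq_mid mulr0 divfK //.
    by field.
  move=> h hx hy hmid _; exists 1; rewrite scale1r nf_ext_free_empty //.
  rewrite mulmxDr mulmxBr -scalemxAr hmid hx hy flst scalerA /f.
  by rewrite addrACA addNr addr0 addrC subrK.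
have [i1 Ei1 i1min] : exists2 i, E ((tau^-1)%g i) & forall j, E ((tau^-1)%g j) -> (i <= j)%N.
  pose P i := E ((tau^-1)%g i).
  by case: (@arg_minnP _ i0 P (fun i : 'I_l => i : nat) Ei0) => i Ei imin; exists i.
(* With these coefficients, y is the combination of the other columns that projects to the image
   under h' of the first free column. Both y and column p have e_0-coordinate 1, so their difference
   can serve as f. *)
pose w := invmx T *m delta_mx i1 0 : 'cV_l.
pose y := colsub (lift p) A *m w.
have yA : y = A *m \col_i oapp (fun j => w j 0) 0 (unlift p i) by apply: colsub_lift_mul.
have ymid : (inj_mx F l)^T *m y = h' *m col i1 (nf_mx F E S tau).
  by rewrite mulmxA A'E mulmxA mulmxK // -mulmxA -colE.
have ylst : y (lst_idx l) 0 = 0 by rewrite mxE big1 // => i _; rewrite !mxE Alst mul0r.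
have y1 : y mid 0 = 1.
  by rewrite -emb_mid -tr_inj_mxE ymid mulmx_mid_fixed // !mxE frame_mid Ei1.
have yf v : bform (A *m v) (col p A - y) = 0 by rewrite yA colE -mulmxBr bform_mx.
have flst : (col p A - y) (lst_idx l) 0 = t by rewrite mxE [X in _ + X]mxE ylst subr0 mxE.
apply: (@has_nf_assemble F l A p h' E S tau T (col p A - y) true true) => //.
  split; last by move=> k; rewrite colE.
  - by rewrite {1}yA colE -mulmxBr -colE.
  - by rewrite mxE [X in _ + X]mxE y1 mxE Ap2 subrr.
  - by rewrite flst.
move=> h hx hy _ huniq; exists 1; rewrite scale1r.
rewrite (@nf_ext_free F l E S tau p true true i1) //; last exact: ep.
rewrite mulmxDr hy -(huniq y) ?subrKC //.
by rewrite {1}yA.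
Qed.

End NormalFormStep.

(** * Column operations and existence of the normal form *)

Section ColumnReduction.
Variables (F : numClosedFieldType) (m : nat) (p : 'I_m) (u : 'cV[F]_m) (r : 'I_m -> F).

(** A change of basis of the flag. The multiples r are those of the original column p, not of its
    replacement. *)
Definition elim_mx : 'M[F]_m := \matrix_(i, k)
  if k == p then u i 0 else (i == k)%:R + ((i == p) && (p < k)%N)%:R * r k.

Lemma elim_mx_upper : (forall i : 'I_m, (p < i)%N -> u i 0 = 0) -> upper_mx elim_mx.
Proof.
move=> u0 i k ki; rewrite mxE; case: eqP => [kp|_]; first by apply: u0; rewrite -kp.
rewrite -val_eqE gtn_eqF // add0r; case: eqP => [ip|_] /=; last by rewrite mul0r.
by rewrite -ip ltnNge ltnW // mul0r.
Qed.

Lemma elim_mx_unit :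
  (forall i : 'I_m, (p < i)%N -> u i 0 = 0) -> u p 0 != 0 -> elim_mx \in unitmx.
Proof.
move=> u0 up; rewrite unitmxE unitfE det_upper; last exact: elim_mx_upper.
apply/prodf_neq0 => i _; rewrite mxE; have [->//|ip] := eqVneq i p.
by rewrite eqxx mul0r addr0 oner_eq0.
Qed.

Lemma col_elim_mx n (A : 'M[F]_(n, m)) k : col k (A *m elim_mx)
  = if k == p then A *m u else col k A + ((p < k)%N%:R * r k) *: col p A.
Proof.
rewrite mulmx_col_sum; case: eqP => [->|/eqP kp].
  apply/colP => i; rewrite summxE mxE; apply: eq_bigr => j _.
  by rewrite !mxE eqxx mulrC.
rewrite (bigD1 k) //= (bigD1 p) 1?eq_sym //= big1 => [|j /andP[jk jp]]; last first.
  by rewrite mxE (negPf kp) (negPf jk) (negPf jp) mul0r addr0 scale0r.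
by rewrite !mxE (negPf kp) !eqxx /= mul0r addr0 scale1r [p == k]eq_sym (negPf kp) add0r addr0.
Qed.

End ColumnReduction.

Section ExistsNormalForm.
Variable F : numClosedFieldType.

Lemma has_nf_mul l (A : 'M[F]_(l.*2.+1, l)) T :
  upper_mx T -> T \in unitmx -> has_nf (A *m T) -> has_nf A.
Proof.
move=> uT Tu [h [E [S [tau [T' [ch vc uT' AT]]]]]].
exists h, E, S, tau, (T' *m invmx T); split=> //.
  by apply: upper_mxM => //; apply: upper_mxV.
by rewrite mulmxA -AT mulmxK.
Qed.

(* A is maximal isotropic, so the isotropic vector e_1, being orthogonal to its
   columns, is in their span. *)
Lemma fst_in_span l (A : 'M[F]_(l.+1.*2.+1, l.+1)) :
  A^T *m revmx *m A = 0 -> row_free A^T -> (forall k, A (lst_idx l) k = 0) ->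
  exists u : 'cV[F]_l.+1, A *m u = delta_mx (fst_idx l) 0.
Proof.
move=> isoA freeA Al; have [g [og _ gA]] := witt_extension isoA freeA.
pose x : 'cV[F]_(l.+1.*2.+1) := delta_mx (fst_idx l) 0.
pose y := invmx g *m x; have gy : g *m y = x by rewrite mulKVmx // orthogonal_unit.
have yhi k : y (hi k) 0 = 0.
  rewrite -[LHS]bform_deltal -(bform_orthogonal _ _ og) gy -colE gA.
  by rewrite bform_deltar rev_fst mxE Al.
clearbody y; have ymid : y mid 0 = 0.
  have yy : bform y y = 0.
    rewrite -(bform_orthogonal _ _ og) gy bform_deltal rev_fst mxE.
    by rewrite eq_sym fst_neq_lst.
  pose z := y - y mid 0 *: delta_mx mid 0.
  have zm : z mid 0 = 0 by rewrite !mxE !eqxx mulr1 subrr.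
  have zz : bform z z = 0.
    apply: bform_self_lo => // k.
    by rewrite !mxE yhi hi_neq_mid mulr0 subrr.
  move: yy; have -> : y = z + y mid 0 *: delta_mx mid 0 by rewrite subrK.
  rewrite bformDl bformDr zz bformZr bform_deltar rev_mid zm mulr0 !add0r.
  rewrite bformDr !bformZl bform_deltal rev_mid zm mulr0 add0r bformZr bform_deltal rev_mid.
  rewrite [delta_mx _ _ _ _]mxE !eqxx mulr1 => /eqP; rewrite mulf_eq0 orbb => /eqP y0.
  by rewrite mxE zm add0r mxE y0 mul0r.
exists (\col_k y (lo k) 0); rewrite -/x -gy.
have -> : A = lcols g by apply/matrixP => i k; move/colP/(_ i): (gA k); rewrite !mxE.
rewrite -[g in LHS]mulmx1 -mulmx_lcols -mulmxA; congr (_ *m _); apply/colP => i; rewrite mxE.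
case: (idxP i) => [k||k].
- rewrite (bigD1 k) //= !mxE eqxx mul1r big1 ?addr0 // => j jk.
  by rewrite !mxE (inj_eq (@lo_inj _)) eq_sym (negPf jk) mul0r.
- rewrite ymid big1 // => j _; by rewrite !mxE eq_sym lo_neq_mid mul0r.
- rewrite yhi big1 // => j _; by rewrite !mxE eq_sym lo_neq_hi mul0r.
Qed.

Lemma exists_nf l (A : 'M[F]_(l.*2.+1, l)) :
  A^T *m revmx *m A = 0 -> row_free A^T -> has_nf A.
Proof.
elim: l A => [|l IH] A isoA freeA.
  exists 1%:M, xpred0, xpred0, 1%g, 0; split=> //.
  - by split; rewrite ?mul1mx // /orthogonal_mx ?trmx1 ?mul1mx ?mulmx1 //; apply: upper_mx1.
  - by move=> [].
  - by apply/matrixP => i [].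
suff [p [T [uT Tu Tlst Tp]]] : exists p T, [/\ upper_mx T, T \in unitmx,
    forall k, (A *m T) (lst_idx l) (lift p k) = 0 &
    [\/ col p (A *m T) = delta_mx (fst_idx l) 0,
      (A *m T) (lst_idx l) p != 0 /\ (A *m T) mid p = 0 |
      [/\ (A *m T) (lst_idx l) p != 0, (A *m T) mid p = 1 &
         forall k : 'I_l.+1, (k < p)%N -> (A *m T) mid k = 0]]].
  apply: (has_nf_mul uT Tu).
  have isoT : (A *m T)^T *m revmx *m (A *m T) = 0.
    by rewrite trmx_mul -!mulmxA (mulmxA revmx) (mulmxA A^T) (mulmxA A^T) isoA mul0mx mulmx0.
  have freeT : row_free (A *m T)^T.
    apply: inj_row_free => v; rewrite trmx_mul mulmxA => /eqP.
    by rewrite mulmx_free_eq0 // mulmx_free_eq0 ?row_free_unit ?unitmx_tr // => /eqP.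
  apply: (has_nf_step isoT freeT Tlst Tp); apply: IH.
    exact: step_isotropic.
  exact: step_free.
have colE' (M : 'M[F]_(l.+1.*2.+1, l.+1)) i k : M i k = col k M i 0 by rewrite mxE.
have [j0 Aj0|A0] := pickP (fun k => A (lst_idx l) k != 0); last first.
  have {}A0 k : A (lst_idx l) k = 0 by apply/eqP; rewrite -[_ == _]negbK A0.
  have [u Au] := fst_in_span isoA freeA A0.
  have [i0 ui0] : exists i, u i 0 != 0.
    apply: contrapT => nou; have u0 : u = 0.
      by apply/colP => i; rewrite mxE; apply: contrapT => /eqP ui; apply: nou; exists i.
    move/colP/(_ (fst_idx l)): Au; rewrite u0 mulmx0 !mxE eqxx => /esym/eqP.
    by rewrite oner_eq0.
  (* The last coordinate of u in use marks the first step of the flag that contains e_1. *)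
  have [p up pmax] : exists2 p, u p 0 != 0 & forall i : 'I_l.+1, (p < i)%N -> u i 0 = 0.
    pose P i := u i 0 != 0.
    case: (@arg_maxnP _ i0 P (fun i : 'I_l.+1 => i : nat) ui0) => p up pmax.
    exists p => // i pi; apply: contrapT => /eqP /pmax /=.
    by rewrite leqNgt => /negP; apply.
  exists p, (elim_mx p u (fun=> 0)); split.
  - exact: elim_mx_upper.
  - exact: elim_mx_unit.
  - move=> k; rewrite colE' col_elim_mx eq_sym (negPf (neq_lift _ _)) mulr0 scale0r addr0.
    by rewrite mxE A0.
  - by constructor 1; rewrite col_elim_mx eqxx.
have [p Alp pmin] : exists2 p, A (lst_idx l) p != 0 &
    forall k : 'I_l.+1, (k < p)%N -> A (lst_idx l) k = 0.
  pose P i := A (lst_idx l) i != 0.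
  case: (@arg_minnP _ j0 P (fun i : 'I_l.+1 => i : nat) Aj0) => p Ap pmin.
  exists p => // i pi; apply: contrapT => /eqP /pmin /=.
  by rewrite leqNgt => /negP; apply.
(* Clears the e_{-1}-coordinates of the columns after p; the earlier ones are already 0. *)
pose r k := - (A (lst_idx l) k / A (lst_idx l) p).
have lstP u k : (A *m elim_mx p u r) (lst_idx l) (lift p k) = 0.
  rewrite colE' col_elim_mx eq_sym (negPf (neq_lift _ _)) !mxE.
  have := neq_lift p k; rewrite neq_ltn => /orP[pk|kp].
    by rewrite pk mul1r /r mulNr divfK // subrr.
  by rewrite pmin // add0r ltnNge ltnW // !mul0r.
have [Ap0|Ap0] := eqVneq (A mid p) 0.
  exists p, (elim_mx p (delta_mx p 0) r); split=> //.
  - by apply: elim_mx_upper => i pi; rewrite !mxE -val_eqE gtn_eqF.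
  - apply: elim_mx_unit => [i pi|]; first by rewrite !mxE -val_eqE gtn_eqF.
    by rewrite mxE !eqxx oner_eq0.
  - by constructor 2; rewrite !colE' col_elim_mx eqxx -colE -!colE'.
have [k0 /andP[k0p Ak0]|nok] := pickP (fun k : 'I_l.+1 => (k < p)%N && (A mid k != 0)).
  (* Column k0 has an e_0-coordinate but no e_{-1}-coordinate, so it brings column p into e_0^perp
     and keeps its leading term. *)
  pose u : 'cV[F]_l.+1 := delta_mx p 0 - (A mid p / A mid k0) *: delta_mx k0 0.
  have k0p' : k0 != p by rewrite -val_eqE neq_ltn k0p.
  have uu (i : 'I_l.+1) : (p < i)%N -> u i 0 = 0.
    move=> pi; have ip : (i == p) = false by rewrite -val_eqE gtn_eqF.
    have ik : (i == k0) = false by rewrite -val_eqE gtn_eqF // (ltn_trans k0p).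
    by rewrite !mxE ip ik mulr0 subrr.
  exists p, (elim_mx p u r); split=> //.
  - exact: elim_mx_upper.
  - apply: elim_mx_unit => //.
    by rewrite !mxE !eqxx [_ == k0]eq_sym (negPf k0p') mulr0 subr0 oner_eq0.
  constructor 2; rewrite !colE' col_elim_mx eqxx mulmxBr -scalemxAr -!colE !mxE.
  by rewrite (pmin k0) // mulr0 subr0 divfK // subrr.
have {}nok (k : 'I_l.+1) : (k < p)%N -> A mid k = 0.
  by move=> kp; apply/eqP; have := nok k; rewrite kp => /negbFE.
(* With no earlier column to clear it, the e_0-coordinate of column p is scaled to 1: the free
   case. *)
exists p, (elim_mx p ((A mid p)^-1 *: delta_mx p 0) r); split=> //.
- by apply: elim_mx_upper => i pi; rewrite !mxE -val_eqE gtn_eqF // mulr0.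
- apply: elim_mx_unit => [i pi|]; first by rewrite !mxE -val_eqE gtn_eqF // mulr0.
  by rewrite !mxE !eqxx mulr1 invr_eq0.
constructor 3; split.
- by rewrite (colE' (A *m _)) col_elim_mx eqxx -scalemxAr -colE !mxE mulf_neq0 ?invr_eq0.
- by rewrite (colE' (A *m _)) col_elim_mx eqxx -scalemxAr -colE !mxE mulVf.
move=> k kp; rewrite (colE' (A *m _)) col_elim_mx -val_eqE ltn_eqF // !mxE nok // add0r.
by rewrite ltnNge ltnW // !mul0r.
Qed.

End ExistsNormalForm.

(** * Uniqueness of the normal form *)

Lemma big_lo_mid_hi (R : Type) (idx : R) (op : Monoid.com_law idx) l (f : 'I_l.*2.+1 -> R) :
  \big[op/idx]_i f i =
  op (op (\big[op/idx]_k f (lo k)) (f mid)) (\big[op/idx]_k f (hi k)).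
Proof.
elim: l f => [|l IH] f.
  rewrite big_ord1 !big_ord0 Monoid.mul1m Monoid.mulm1; congr f.
  by apply/val_inj; rewrite /= val_mid.
rewrite [LHS]big_ord_recl [X in op _ X]big_ord_recr /=.
rewrite (eq_bigr (fun r => f (emb r))) => [|r _]; last by congr f; apply/val_inj.
rewrite IH emb_mid ![in RHS]big_ord_recl.
have -> : lift ord0 ord_max = hi ord0 :> 'I_(l.+1.*2.+1) by apply/val_inj; rewrite /= subn1.
have -> : ord0 = lo ord0 :> 'I_(l.+1.*2.+1) by apply/val_inj.
have -> : \big[op/idx]_k f (emb (lo k)) = \big[op/idx]_k f (lo (lift ord0 k)).
  by apply: eq_bigr => k _; rewrite emb_lo.
have -> : \big[op/idx]_k f (emb (hi k)) = \big[op/idx]_k f (hi (lift ord0 k)).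
  by apply: eq_bigr => k _; rewrite emb_hi.
by rewrite !Monoid.mulmA [LHS]Monoid.mulmAC.
Qed.

Section NormalFormUniqueness.
Variables (F : numClosedFieldType) (l : nat).
Notation N := l.*2.+1.

Section Lead.
Variables (E S : 'I_l -> bool) (tau : 'S_l).
Hypothesis valid : valid_code E S tau.
Local Notation nf := (nf_mx F E S tau).

(* The last row other than the one of e_0 in which column i of the normal form
   is nonzero. *)
Definition lead (i : 'I_l) : 'I_N :=
  let k := (tau^-1)%g i in if S k then hi k else lo k.

Lemma lead_inj : injective lead.
Proof.
move=> i j; rewrite /lead; case: ifP => _; case: ifP => _ /eqP.
- by rewrite (inj_eq (@hi_inj _)) => /eqP /perm_inj.
- by rewrite eq_sym lo_neq_hi.
- by rewrite lo_neq_hi.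
- by rewrite (inj_eq (@lo_inj _)) => /eqP /perm_inj.
Qed.

Lemma lead_neq_mid i : (lead i == mid) = false.
Proof. by rewrite /lead; case: ifP; rewrite ?hi_neq_mid ?lo_neq_mid. Qed.

Lemma nf_mid i : nf mid i = (E ((tau^-1)%g i))%:R.
Proof. by rewrite mxE frame_mid. Qed.

Lemma nf_lead i : nf (lead i) i = 1.
Proof.
have [ES incr] := valid; rewrite mxE /lead; set k := (tau^-1)%g i.
have tk : tau k = i by rewrite permKV.
case Sk : (S k); rewrite ?frame_hi ?frame_lo tk ?Sk eqxx ?leqnn.
  by case: (E k).
by case: ifP => // /ES; rewrite Sk.
Qed.

Lemma nf_above_lead i (r : 'I_N) : (lead i < r)%N -> r != mid -> nf r i = 0.
Proof.
have [ES incr] := valid; rewrite mxE /lead; set k := (tau^-1)%g i.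
have tk : tau k = i by rewrite permKV.
case: (idxP r) => [k'||k']; rewrite ?eqxx ?frame_lo ?frame_hi //.
- move=> lt_r _; case: ifP => [/ES Sk|_].
    by exfalso; move: lt_r; rewrite Sk /=; have := ltn_ord k; have := ltn_ord k'; lia.
  have [tk'|] := eqVneq (tau k') i; last by rewrite andbF.
  have kk' : k' = k by rewrite /k -tk' permK.
  by move: lt_r; rewrite kk'; case: (S k) => //=; rewrite ltnn.
- move=> lt_r _; case: ifP => [Ek|_].
    move: lt_r; rewrite (ES _ Ek) => lt_r.
    case Ek': (E k') => //=; rewrite -tk leqNgt incr //.
    by move: lt_r => /=; have := ltn_ord k; have := ltn_ord k'; lia.
  have [tk'|] := eqVneq (tau k') i; last by rewrite andbF.
  have kk' : k' = k by rewrite /k -tk' permK.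
  by move: lt_r; rewrite kk'; case: (S k) => //=; rewrite ltnn.
Qed.

(** The leading rows of the columns are distinct, so the largest one among nonzero coefficients
    cannot cancel. *)
Lemma nf_mul_lead (x : 'cV[F]_l) : x != 0 ->
  exists i, [/\ (nf *m x) (lead i) 0 = x i 0, x i 0 != 0,
    forall j, x j 0 != 0 -> (lead j <= lead i)%N &
    forall r : 'I_N, (lead i < r)%N -> r != mid -> (nf *m x) r 0 = 0].
Proof.
move=> x0; have [i0 xi0] : exists i, x i 0 != 0.
  apply: contrapT => nox; case/eqP: x0; apply/colP => i; rewrite mxE.
  by apply: contrapT => /eqP xi; apply: nox; exists i.
case: (@arg_maxnP _ i0 (fun i => x i 0 != 0) (fun i => lead i : nat) xi0) => i xi imax.
have above j (r : 'I_N) : (lead i <= r)%N -> r != mid ->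
    (x j 0 != 0 -> lead j != r) -> nf r j * x j 0 = 0.
  move=> ir rmid jr; have [->|xj] := eqVneq (x j 0) 0; first by rewrite mulr0.
  by rewrite nf_above_lead ?mul0r // ltn_neqAle jr // (leq_trans (imax _ xj)).
exists i; split=> // [|r ir rmid].
  rewrite mxE (bigD1 i) //= nf_lead mul1r big1 ?addr0 // => j ji.
  by rewrite above ?lead_neq_mid // (inj_eq lead_inj).
rewrite mxE big1 // => j _; rewrite above // ?(ltnW ir) // => xj.
by rewrite -val_eqE neq_ltn (leq_ltn_trans (imax _ xj)).
Qed.

Lemma nf_free : row_free nf^T.
Proof.
apply: inj_row_free => v /(congr1 trmx); rewrite trmx_mul trmxK trmx0 => v0.
apply: trmx_inj; rewrite trmx0; apply/eqP; apply: contraT => /nf_mul_lead[i [+ xi _ _]].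
by rewrite v0 mxE => /esym/eqP; rewrite (negPf xi).
Qed.

Lemma nf_isotropic : nf^T *m revmx *m nf = 0.
Proof.
have [ES incr] := valid.
apply/matrixP => i j; rewrite -mulmxA [RHS]mxE mxE.
under eq_bigr do rewrite mul_revmx mxE.
rewrite big_lo_mid_hi /= rev_mid !nf_mid.
under [X in X + _ + _]eq_bigr do rewrite -/(hi _) !mxE frame_lo frame_hi.
under [X in _ + X]eq_bigr do rewrite rev_hi !mxE frame_lo frame_hi.
have disj i' k : E ((tau^-1)%g i') = false -> tau k = i' -> E k = false.
  by move=> Ei tk; rewrite -Ei -tk permK.
have [Ei|Ei] := boolP (E ((tau^-1)%g i)); have [Ej|Ej] := boolP (E ((tau^-1)%g j)).
- have [m Em mmax] : exists2 m, E m & forall k, E k -> (k <= m)%N.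
    by case: (@arg_maxnP _ _ E (fun k : 'I_l => k : nat) Ei) => m Em mmax; exists m.
  have last_m k : E k && is_last E k = (k == m).
    apply/andP/eqP => [[Ek /forallP kl]|->].
      by apply/val_inj/eqP; rewrite eqn_leq mmax //=; have := kl m; rewrite Em.
    by split=> //; apply/forallP => k'; apply/implyP => /mmax.
  have tm i' : E ((tau^-1)%g i') -> (i' <= tau m)%N.
    move=> Ei'; rewrite -{1}(permKV tau i'); have := mmax _ Ei'; rewrite leq_eqVlt.
    by move=> /orP[/eqP/val_inj->//|lt_km]; apply/ltnW/incr.
  have half i' : E ((tau^-1)%g i') ->
      \sum_k (- 2^-1 * (E k && is_last E k)%:R * (E k && (i' <= tau k)%N)%:R) = - 2^-1 :> F.
    move=> Ei'; rewrite (bigD1 m) //= last_m eqxx Em tm // !mulr1 big1 ?addr0 // => k km.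
    by rewrite last_m (negPf km) mulr0 mul0r.
  rewrite half //; under [X in _ + X]eq_bigr do rewrite mulrC.
  by rewrite half //= mulr1n mulr1; field.
- rewrite [false%:R]mulr0n mulr0 addr0 !big1 ?addr0 // => k _.
    have [tk|] := eqVneq (tau k) j; last by rewrite !andbF /= mulr0n ?mulr0 ?mul0r.
    by rewrite (disj j k) ?(negbTE Ej) //= mulr0n ?mulr0 ?mul0r.
  have [tk|] := eqVneq (tau k) j; last by rewrite !andbF /= mulr0n ?mulr0 ?mul0r.
  by rewrite (disj j k) ?(negbTE Ej) //= mulr0n ?mulr0 ?mul0r.
- rewrite [false%:R]mulr0n mul0r addr0 !big1 ?addr0 // => k _.
    have [tk|] := eqVneq (tau k) i; last by rewrite !andbF /= mulr0n ?mulr0 ?mul0r.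
    by rewrite (disj i k) ?(negbTE Ei) //= mulr0n ?mulr0 ?mul0r.
  have [tk|] := eqVneq (tau k) i; last by rewrite !andbF /= mulr0n ?mulr0 ?mul0r.
  by rewrite (disj i k) ?(negbTE Ei) //= mulr0n ?mulr0 ?mul0r.
- rewrite [false%:R]mulr0n mul0r addr0 !big1 ?addr0 // => k _.
    have [ti|] := eqVneq (tau k) j; last by rewrite !andbF /= mulr0n ?mulr0 ?mul0r.
    by case: (S k); rewrite /= ?mulr0n ?mulr0 ?mul0r.
  have [ti|] := eqVneq (tau k) j; last by rewrite !andbF /= mulr0n ?mulr0 ?mul0r.
  by case: (S k); rewrite /= ?mulr0n ?mulr0 ?mul0r.
Qed.

End Lead.

(** Fixing e_0 and being triangular, h preserves leading rows; triangularity of T lets them be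
    matched by induction on the column. Only one inclusion between E and E' results here; the
    reverse one comes from the inverse of h. *)
Lemma nf_unique (E S E' S' : 'I_l -> bool) (tau tau' : 'S_l) (h : 'M[F]_N) (T : 'M[F]_l) :
  valid_code E S tau -> valid_code E' S' tau' ->
  orthogonal_mx h -> upper_mx h -> h *m delta_mx mid 0 = delta_mx mid 0 :> 'cV_N ->
  upper_mx T -> nf_mx F E S tau *m T = h *m nf_mx F E' S' tau' ->
  [/\ tau = tau', S =1 S' & forall k, E k -> E' k].
Proof.
move=> vc vc' oh uh hmid uT hnf; have hu := orthogonal_unit oh.
have hrm r : r != mid -> h r mid = 0.
  move=> rm; move/colP/(_ r): hmid; rewrite -colE !mxE => ->.
  by rewrite (negPf rm).
pose v i := h *m col i (nf_mx F E' S' tau').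
have vlead i : v i (lead S' tau' i) 0 != 0.
  rewrite mxE (bigD1 (lead S' tau' i)) //= [X in _ * X]mxE nf_lead // mulr1.
  rewrite big1 ?addr0 ?upper_unit_diag // => r rl.
  have [->|rm] := eqVneq r mid; first by rewrite hrm ?mul0r // lead_neq_mid.
  have [lr|rl'] := ltnP (lead S' tau' i) r.
    by rewrite [X in _ * X]mxE nf_above_lead ?mulr0.
  by rewrite uh ?mul0r // ltn_neqAle rl.
have vabove i (r : 'I_N) : (lead S' tau' i < r)%N -> r != mid -> v i r 0 = 0.
  move=> lr rm; rewrite mxE big1 // => r' _.
  have [->|rm'] := eqVneq r' mid; first by rewrite hrm ?mul0r.
  have [lr'|rl'] := ltnP r' r; first by rewrite uh ?mul0r.
  by rewrite [X in _ * X]mxE nf_above_lead ?mulr0 // (leq_trans lr).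
have vE i : v i = nf_mx F E S tau *m col i T by rewrite /v -!col_mulmx hnf.
have key i : exists i', [/\ lead S tau i' = lead S' tau' i, T i' i != 0 &
    forall j, T j i != 0 -> (lead S tau j <= lead S tau i')%N].
  have x0 : col i T != 0.
    by apply: contraNneq (vlead i) => x0; rewrite vE x0 mulmx0 mxE.
  have [i' [vi' Ti' imax iabove]] := nf_mul_lead vc x0.
  move: Ti'; rewrite mxE => Ti'.
  exists i'; split=> // [|j Tj]; last by apply: imax; rewrite mxE.
  apply/val_inj/eqP; rewrite eqn_leq; apply/andP; split; rewrite leqNgt; apply/negP => lt_l.
    move: vi'; rewrite -vE vabove ?lead_neq_mid // mxE => /esym/eqP.
    by rewrite (negPf Ti').
  by have := vlead i; rewrite vE iabove ?eqxx ?lead_neq_mid.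
have leadE i : lead S tau i = lead S' tau' i.
  have [d] := ubnP i; elim: d i => // d IH i id; have [i' [li' Ti' _]] := key i.
  have [lt_i|lt_i|ii'] := ltngtP i' i.
  - have := IH i' (leq_trans lt_i id); rewrite li' => /lead_inj ii'.
    by move: lt_i; rewrite ii' ltnn.
  - by move: Ti'; rewrite uT ?eqxx.
  - by rewrite -li' (val_inj ii').
have tE i : ((tau^-1)%g i = (tau'^-1)%g i) * (S ((tau^-1)%g i) = S' ((tau^-1)%g i)).
  move: (leadE i); rewrite /lead; case Sb: (S _); case Sa: (S' _) => /eqP.
  - by rewrite (inj_eq (@hi_inj _)) => /eqP ti; split=> //; rewrite ti Sa.
  - by rewrite eq_sym lo_neq_hi.
  - by rewrite lo_neq_hi.
  - by rewrite (inj_eq (@lo_inj _)) => /eqP ti; split=> //; rewrite ti Sa.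
have tt : tau = tau' by apply: invg_inj; apply/permP => i; rewrite tE.
split=> // [k|k Ek]; first by rewrite -(permK tau k) tE.
apply: contraT => E'k; pose i := tau k.
have [ES incr] := vc.
have [i' [+ Ti imax]] := key i; rewrite leadE => /lead_inj ii'; subst i'.
have : v i mid 0 = 0.
  rewrite mulmx_mid_fixed // mxE nf_mid -tt permK.
  by rewrite (negPf E'k).
rewrite vE mxE (bigD1 i) //= nf_mid permK Ek mul1r big1 ?addr0 ?mxE => [/eqP|j ji].
  by rewrite (negPf Ti).
rewrite nf_mid mxE; have [->|Tj] := eqVneq (T j i) 0; first by rewrite mulr0.
case Ej: (E _); last by rewrite mul0r.
have ji' : (j < i)%N.
  rewrite ltn_neqAle ji /= leqNgt; apply: contra Tj => ij; by rewrite uT.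
have := imax _ Tj; rewrite /lead /i permK (ES _ Ek) (ES _ Ej) /= => lji.
have : ((tau^-1)%g j < k)%N.
  rewrite ltnNge; apply/negP; rewrite leq_eqVlt => /orP[/eqP/val_inj kj|lt_k].
    by move: ji'; rewrite /i kj permKV ltnn.
  have := incr _ _ Ek Ej lt_k; rewrite permKV -/i => lt_ij.
  by have := ltn_trans lt_ij ji'; rewrite ltnn.
by move: lji; have := ltn_ord k; have := ltn_ord ((tau^-1)%g j); lia.
Qed.

End NormalFormUniqueness.

(** * Double cosets *)

Section DoubleCosets.
Variables (F : numClosedFieldType) (l : nat).
Notation N := l.*2.+1.
Notation code := ({set 'I_l} * {set 'I_l} * 'S_l)%type.
Implicit Types (g h : 'M[F]_N) (c : code).

Local Notation std := (std_borel F N).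

Definition even_borel h :=
  [/\ orthogonal_mx h, upper_mx h & h *m delta_mx mid 0 = delta_mx mid 0 :> 'cV_N].

Lemma even_borel1 : even_borel 1%:M.
Proof.
split; rewrite ?mul1mx //; last exact: upper_mx1.
by rewrite /orthogonal_mx trmx1 mul1mx mulmx1.
Qed.

Lemma even_borelM g h : even_borel g -> even_borel h -> even_borel (g *m h).
Proof.
move=> [og ug gm] [oh uh hm]; split.
- exact: orthogonalM.
- exact: upper_mxM.
- by rewrite -mulmxA hm.
Qed.

Lemma even_borelV g : even_borel g -> even_borel (invmx g).
Proof.
move=> [og ug gm]; split.
- exact: orthogonalV.
- exact: upper_orthogonalV.
- by rewrite -{1}gm mulKmx // orthogonal_unit.
Qed.

Lemma even_borel_unit g : even_borel g -> g \in unitmx.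
Proof. by case=> og _ _; apply: orthogonal_unit. Qed.

(** The diagonal entries at e_k and e_{-k} are mutually inverse and that at e_0 is 1; this
    identifies [even_borel] with [B_SO_even]. *)
Lemma even_borel_det h : even_borel h -> \det h = 1.
Proof.
move=> [oh uh hm]; rewrite det_upper // big_lo_mid_hi /=.
have -> : h mid mid = 1 by move/colP/(_ mid): hm; rewrite -colE !mxE !eqxx.
rewrite mulr1 -big_split /= big1 // => k _.
exact: upper_orthogonal_diag.
Qed.

Lemma lcols_upper (b : 'M[F]_N) : upper_mx b ->
  exists2 T : 'M_l, upper_mx T & lcols b = lcols 1%:M *m T.
Proof.
move=> ub; exists (\matrix_(i, k) b (lo i) (lo k)).
  by move=> i k ki; rewrite mxE; apply: ub.
apply/matrixP => r k; rewrite mxE [RHS]mxE; case: (idxP r) => [i||i].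
- rewrite (bigD1 i) //= !mxE eqxx mul1r big1 ?addr0 // => j ji.
  by rewrite !mxE (inj_eq (@lo_inj _)) eq_sym (negPf ji) mul0r.
- rewrite ub ?big1 // => [j _|]; first by rewrite !mxE eq_sym lo_neq_mid mul0r.
  by rewrite val_mid /=.
- rewrite ub ?big1 // => [j _|]; first by rewrite !mxE eq_sym lo_neq_hi mul0r.
  by rewrite /=; have := ltn_ord i; have := ltn_ord k; lia.
Qed.

Definition nf_code c : 'M[F]_(N, l) :=
  nf_mx F (fun k => k \in c.1.1) (fun k => k \in c.1.2) c.2.

Lemma codesP c : c \in codes l <->
  valid_code (fun k => k \in c.1.1) (fun k => k \in c.1.2) c.2.
Proof.
rewrite inE; split=> [/andP[/fintype.subsetP ES /incr_onP incr]|[ES incr]].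
  by split.
by apply/andP; split; [apply/fintype.subsetP|apply/incr_onP].
Qed.

(** Representatives of the double cosets: elements of SO(2l+1) whose flags are the normal forms. *)
Definition code_frame (g : code -> 'M[F]_N) := forall c, c \in codes l ->
  [/\ orthogonal_mx (g c), \det (g c) = 1 & lcols (g c) = nf_code c].

Lemma exists_code_frame : exists f : code -> 'M[F]_N, code_frame f.
Proof.
suff /choice[f fP] : forall c, exists g, c \in codes l ->
    [/\ orthogonal_mx g, \det g = 1 & lcols g = nf_code c] by exists f.
move=> c; have [/codesP vc|_] := boolP (c \in codes l); last by exists 0.
have [g [og dg gc]] := witt_extension (nf_isotropic F vc) (nf_free F vc).
exists g => _; split=> //; apply/matrixP => i k.
by move/colP/(_ i): (gc k); rewrite [LHS]mxE [RHS]mxE => <-; rewrite mxE.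
Qed.

Variable g : code -> 'M[F]_N.
Hypothesis gP : code_frame g.

Lemma double_coset_code_sub c c' h : c \in codes l -> c' \in codes l ->
  even_borel h -> Ad (g c) std = Ad h (Ad (g c') std) ->
  [/\ c.2 = c'.2, c.1.2 = c'.1.2 & {subset c.1.1 <= c'.1.1}].
Proof.
move=> cc cc' [oh uh hm]; have [og _ gc] := gP cc; have [og' _ gc'] := gP cc'.
have gu := orthogonal_unit og; have hu := orthogonal_unit oh.
rewrite -(AdM std hu (orthogonal_unit og')).
move=> /(Ad_std_borel_eq og (orthogonalM oh og')) /lcols_upper[T uT bT].
have nfT : nf_code c *m T = h *m nf_code c'.
  rewrite -gc -gc' mulmx_lcols -[h *m g c'](mulKVmx gu) -mulmx_lcols bT.
  by rewrite mulmxA mulmx_lcols mulmx1.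
have /codesP vc := cc; have /codesP vc' := cc'.
have [-> SS EE] := nf_unique vc vc' oh uh hm uT nfT; split=> //.
by apply/setP => k; apply: SS.
Qed.

Lemma double_coset_code_inj c c' h : c \in codes l -> c' \in codes l ->
  even_borel h -> Ad (g c) std = Ad h (Ad (g c') std) -> c = c'.
Proof.
move=> cc cc' Bh gh; have hu := even_borel_unit Bh.
have [ct cS cE] := double_coset_code_sub cc cc' Bh gh.
have hg : Ad (g c') std = Ad (invmx h) (Ad (g c) std).
  have hVu : invmx h \in unitmx by rewrite unitmx_inv.
  have [og' _ _] := gP cc'; have gu' := orthogonal_unit og'.
  by rewrite gh -(AdM std hu gu') -(AdM std hVu) ?mulKmx // unitmx_mul hu.
have [_ _ cE'] := double_coset_code_sub cc' cc (even_borelV Bh) hg.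
case: c c' ct cS cE cE' {cc cc' gh hg} => [[E S] t] [[E' S'] t'] /= -> -> EE' E'E.
by congr (_, _, _); apply/setP => k; apply/idP/idP; [exact: EE'|exact: E'E].
Qed.

Lemma double_coset_exists (b : {vspace 'M[F]_N}) : borel_subalgebra (@so_set F N) b ->
  exists2 c, c \in codes l & exists2 h, even_borel h & b = Ad h (Ad (g c) std).
Proof.
move=> /borel_so_conj[g0 [og0 _ ->]]; have g0u := orthogonal_unit og0.
have isoA : (lcols g0)^T *m revmx *m lcols g0 = 0.
  apply/matrixP => i j; rewrite gram_col [RHS]mxE.
  have cE k : col k (lcols g0) = g0 *m delta_mx (lo k) 0.
    by rewrite -colE; apply/colP => r; rewrite !mxE.
  by rewrite !cE bform_orthogonal // bform_deltal mxE eq_sym lo_neq_hi.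
have [h [E [S [tau [T [Bh [ES incr] uT gT]]]]]] := exists_nf isoA (lcols_unit_full g0u).
have hu := even_borel_unit Bh; have [oh uh hm] := Bh.
pose c : code := (finset (fun k => E k), finset (fun k => S k), tau).
have nfc : nf_code c = nf_mx F E S tau.
  by rewrite /nf_code; congr (nf_mx _ _ _ _); apply/funext => k /=; rewrite inE.
have cc : c \in codes l.
  by apply/codesP; split=> [k|k k']; rewrite !inE; [apply: ES|apply: incr].
have [ogc _ gc] := gP cc; have gcu := orthogonal_unit ogc.
exists c => //; exists h => //; have ohg := orthogonalM oh ogc.
rewrite -(AdM std hu gcu); apply/esym/(Ad_std_borel_eq ohg og0).
apply: (upper_orthogonal (T := T)) => //.
  by apply: orthogonalM => //; apply: orthogonalV.
rewrite -mulmx_lcols gT -nfc -gc (invmx_mul hu gcu) !mulmxA (mulmxKV hu).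
by rewrite mulmx_lcols mulVmx.
Qed.

Local Open Scope classical_set_scope.

Lemma card_orbits : (orbits (@Ad F N) [set h | even_borel h]
  [set b | borel_subalgebra (@so_set F N) b] #= `I_#|codes l|)%card.
Proof.
pose orb (b : {vspace 'M[F]_N}) := [set Ad h b | h in [set h | even_borel h]].
have orbM h (b : {vspace 'M[F]_N}) : even_borel h -> orb (Ad h b) = orb b.
  move=> Bh; have hu := even_borel_unit Bh.
  have hVu : invmx h \in unitmx by rewrite unitmx_inv.
  apply/seteqP; split=> _ [k Bk <-]; have ku := even_borel_unit Bk.
    exists (k *m h); first exact: even_borelM.
    exact: AdM.
  exists (k *m invmx h); first by apply: even_borelM => //; apply: even_borelV.
  by rewrite -(AdM b) ?mulmxKV // unitmx_mul ku.
(* A default for [nth], never reached by indices below the number of codes. *)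
pose c0 : code := (finset.set0, finset.set0, 1%g).
pose c i := nth c0 (enum (codes l)) i.
pose f i := orb (Ad (g (c i)) std).
have cP i : (i < #|codes l|)%N -> c i \in codes l.
  by move=> ic; rewrite -mem_enum mem_nth // -cardE.
have -> : orbits (@Ad F N) [set h | even_borel h]
    [set b | borel_subalgebra (@so_set F N) b] = f @` `I_#|codes l|.
  apply/seteqP; split=> [_ [b bflag ->]|_ [i ic <-]].
    have [d dc [h Bh ->]] := double_coset_exists bflag.
    exists (index d (enum (codes l))); first by rewrite /= cardE index_mem mem_enum.
    by rewrite -[RHS]/(orb _) (orbM _ _ Bh) /f /c nth_index ?mem_enum.
  have [og dg _] := gP (cP _ ic); exists (Ad (g (c i)) std) => //.
  by apply/borel_so_conj; exists (g (c i)).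
apply: inj_card_eq => i j /set_mem /= ic /set_mem /= jc fij.
have : f i (Ad (g (c i)) std).
  have [og _ _] := gP (cP _ ic); have gu := orthogonal_unit og.
  exists 1%:M; first exact: even_borel1.
  by rewrite -(AdM std (unitmx1 _ _) gu) mul1mx.
rewrite fij => -[h Bh /esym hE].
have /eqP := double_coset_code_inj (cP _ ic) (cP _ jc) Bh hE.
by rewrite nth_uniq ?enum_uniq -?cardE // => /eqP.
Qed.

End DoubleCosets.

(** * Specialization to the complex groups *)

Section Complexes.
Variables (R : realType) (l : nat).
Notation C := R[i].
Notation N := l.*2.+1.

Lemma beta_bform (u v : 'cV[C]_N) : beta u v = bform u v.
Proof.
by rewrite /bform -mulmxA mxE; apply: eq_bigr => i _; rewrite mul_revmx mxE.
Qed.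

Lemma SO_oddE (g : 'M[C]_N) : SO_odd R l g <-> orthogonal_mx g /\ \det g = 1.
Proof.
split=> [[gb dg]|[/orthogonal_mxP gb dg]]; split=> //.
  by apply/orthogonal_mxP => u v; rewrite -!beta_bform.
by move=> u v; rewrite !beta_bform.
Qed.

Lemma so_oddE : so_odd R l = @so_set C N.
Proof.
apply/funext => X; apply/propext; split=> [Xb|/so_mxP Xb u v]; last by rewrite !beta_bform.
by apply/so_mxP => u v; rewrite -!beta_bform.
Qed.

Lemma B_SO_evenE : B_SO_even R l = [set h | even_borel h]%classic.
Proof.
apply/funext => h; apply/propext; split=> [[[/SO_oddE[oh _] hmid] uh]|Bh]; first by split.
have [oh uh hmid] := Bh; split=> //; split=> //; apply/SO_oddE; split=> //.
exact: even_borel_det.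
Qed.

End Complexes.

Local Open Scope classical_set_scope.
Local Open Scope card_scope.

Theorem proposition3p16 (R : realType) (l : nat) (hl : (1 <= l)%N) :
  orbits (@Ad R[i] l.*2.+1) (B_SO_even R l) (flag_variety R l) #=
  `I_(\sum_(1 <= k < l.+2)
        l`! %/ (k - 1)`! * 'C(l, k - 1) * 2 ^ (l.+1 - k))%N.
Proof.
have [g gP] := exists_code_frame R[i] l.
by rewrite -card_codes B_SO_evenE /flag_variety so_oddE; apply: card_orbits gP.
Qed.
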